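(* Let $\mathbf{H}\in\mathbb{H}^4$. The following are equivalent: (1) $\mathbf{H}$ is monoclinic; (2) $\mathbf{Cov}_2(\mathbf{H})$ is monoclinic; (3) the triple $(\mathbf{d}_2,\mathbf{c}_3,\mathbf{c}_4)$ is monoclinic. In that case the symmetry group of $\mathbf{H}$ equals the symmetry group of $(\mathbf{d}_2,\mathbf{c}_3,\mathbf{c}_4)$.
   Context: $\mathbb{H}^4$ is the space of totally symmetric traceless fourth-order tensors on $\mathbb{R}^3$, with $SO(3)$-action $(g\star\mathbf{T})(x_1,\dots,x_n)=\mathbf{T}(g^{-1}x_1,\dots,g^{-1}x_n)$. $\mathbf{Cov}_2(\mathbf{H})\subset\mathrm{Sym}^2(\mathbb{R}^3)$ is the set of values at $\mathbf{H}$ of all $SO(3)$-equivariant polynomial maps $\mathbb{H}^4\to\mathrm{Sym}^2(\mathbb{R}^3)$. $(\mathbf{H}:\mathbf{H})_{ijkl}=H_{ijmn}H_{mnkl}$, $(\mathbf{H}:\mathbf{a})_{ij}=H_{ijkl}a_{kl}$, $(\operatorname{tr}_{13}\mathbf{A})_{ij}=A_{kikj}$, $\mathbf{d}_2=\operatorname{tr}_{13}(\mathbf{H}:\mathbf{H})$, $\mathbf{c}_3=\mathbf{H}:\mathbf{d}_2$, $\mathbf{c}_4=\mathbf{H}:\mathbf{c}_3$. Symmetry group of a tensor: $\{g\in SO(3):g\star\mathbf{T}=\mathbf{T}\}$; of a family or subspace: intersection; symmetry class: conjugacy class. Monoclinic means class $[\mathbb{Z}_2]$, $\mathbb{Z}_2$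 generated by a rotation by $\pi$. *)

(* Defs.v *)
From HB Require Import structures.
From mathcomp Require Import all_boot all_order all_algebra.
From mathcomp Require Import reals.
Set Implicit Arguments. Unset Strict Implicit. Unset Printing Implicit Defensive.
Import Order.TTheory GRing.Theory Num.Theory.
Local Open Scope ring_scope.

Section Defs.
Variable R : realType.

Definition tensor4 := 'I_3 -> 'I_3 -> 'I_3 -> 'I_3 -> R.

Definition SO3 (g : 'M[R]_3) : Prop := g *m g^T = 1%:M /\ \det g = 1.

(* (g * T)(x1,..,x4) = T(g^-1 x1, .., g^-1 x4), i.e. in components
   (g*T)_{ijkl} = g_{ia} g_{jb} g_{kc} g_{ld} T_{abcd} *)
Definition act4 (g : 'M[R]_3) (T : tensor4) : tensor4 :=
  fun i j k l => \sum_(a < 3) \sum_(b < 3) \sum_(c < 3) \sum_(d < 3)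
    g i a * g j b * g k c * g l d * T a b c d.

Definition act2 (g : 'M[R]_3) (a : 'M[R]_3) : 'M[R]_3 := g *m a *m g^T.

Definition is_sym2 (a : 'M[R]_3) : Prop := a^T = a.

(* totally symmetric: invariant under the transpositions (12),(23),(34),
   which generate S_4 *)
Definition totally_symmetric4 (T : tensor4) : Prop :=
  forall i j k l, T i j k l = T j i k l /\ T i j k l = T i k j l
                  /\ T i j k l = T i j l k.

Definition traceless4 (T : tensor4) : Prop :=
  forall i j k l, \sum_(m < 3) T m m k l = 0 /\ \sum_(m < 3) T i m m l = 0
     /\ \sum_(m < 3) T i j m m = 0 /\ \sum_(m < 3) T m j m l = 0
     /\ \sum_(m < 3) T m j k m = 0 /\ \sum_(m < 3) T i m k m = 0.

Definition in_H4 (T : tensor4) : Prop := totally_symmetric4 T /\ traceless4 T.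

Inductive polyfun4 : (tensor4 -> R) -> Prop :=
| pf_const (c : R) : polyfun4 (fun _ => c)
| pf_coord i j k l : polyfun4 (fun T => T i j k l)
| pf_add p q : polyfun4 p -> polyfun4 q -> polyfun4 (fun T => p T + q T)
| pf_mul p q : polyfun4 p -> polyfun4 q -> polyfun4 (fun T => p T * q T).

Definition equiv_poly_map (f : tensor4 -> 'M[R]_3) : Prop :=
  (forall i j : 'I_3, exists p, polyfun4 p /\
      forall T, in_H4 T -> f T i j = p T)
  /\ (forall T, in_H4 T -> is_sym2 (f T))
  /\ (forall g T, SO3 g -> in_H4 T -> f (act4 g T) = act2 g (f T)).

Definition Cov2 (H : tensor4) (a : 'M[R]_3) : Prop :=
  exists f, equiv_poly_map f /\ a = f H.

Definition dcontr44 (A B : tensor4) : tensor4 :=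
  fun i j k l => \sum_(m < 3) \sum_(n < 3) A i j m n * B m n k l.
Definition dcontr42 (A : tensor4) (a : 'M[R]_3) : 'M[R]_3 :=
  \matrix_(i, j) \sum_(k < 3) \sum_(l < 3) A i j k l * a k l.
Definition tr13 (A : tensor4) : 'M[R]_3 :=
  \matrix_(i, j) \sum_(k < 3) A k i k j.

Definition d2 (H : tensor4) : 'M[R]_3 := tr13 (dcontr44 H H).
Definition c3 (H : tensor4) : 'M[R]_3 := dcontr42 H (d2 H).
Definition c4 (H : tensor4) : 'M[R]_3 := dcontr42 H (c3 H).

Definition symgroup4 (T : tensor4) (g : 'M[R]_3) : Prop :=
  SO3 g /\ forall i j k l, act4 g T i j k l = T i j k l.
Definition symgroup_family2 (S : 'M[R]_3 -> Prop) (g : 'M[R]_3) : Prop :=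
  SO3 g /\ forall a, S a -> act2 g a = a.
Definition triple (H : tensor4) (a : 'M[R]_3) : Prop :=
  a = d2 H \/ a = c3 H \/ a = c4 H.

Definition rot_pi_e3 : 'M[R]_3 :=
  \matrix_(i, j) (if i == j then (if i == 2 :> nat then 1 else -1) else 0).
Definition Z2 (h : 'M[R]_3) : Prop := h = 1%:M \/ h = rot_pi_e3.

Definition in_class_Z2 (G : 'M[R]_3 -> Prop) : Prop :=
  exists g, SO3 g /\ forall h,
    G h <-> exists h', Z2 h' /\ h = g *m h' *m g^T.

Definition monoclinic4 (T : tensor4) : Prop := in_class_Z2 (symgroup4 T).
Definition monoclinic_family2 (S : 'M[R]_3 -> Prop) : Prop :=
  in_class_Z2 (symgroup_family2 S).

End Defs.

(* Main.v *)
Require Import Defs.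
From mathcomp Require Import all_boot all_order all_algebra.
From mathcomp Require Import boolp classical_sets reals topology normedtype derive.
From mathcomp Require Import ring lra.
Set Implicit Arguments. Unset Strict Implicit. Unset Printing Implicit Defensive.
Import Order.TTheory GRing.Theory Num.Theory.
Import numFieldNormedType.Exports.
Local Open Scope ring_scope.

(** The symmetry groups satisfy [G(H) <= G(Cov2 H) <= G(d2, c3, c4)], so everything
    reduces to a dichotomy: if a half-turn [r] fixes [d2], [c3] and [c4], then either
    [G(H)] has two distinct nontrivial elements (and none of the three groups is of
    class [Z_2]), or [r] fixes [H] and [G(d2, c3, c4) = {1, r}].

    Take [r] to be the half-turn about [e3]. As [c3 = H:d2] and [c4 = H:c3], the
    odd-even block of the operator [H] kills [d2] and [c3].

    If [d2], [c3], [c4] do not commute, [d2] and [c3] are independent modulo the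
    identity, which leaves only [H_1113 = - H_1333] in the odd part of [H]; if it
    did not vanish, [d2 e3 // e3] and [d2_11 = d2_33] would force [d2_12 = c3_12 = 0].

    If they commute, diagonalise them simultaneously. When [d2] and [c3] are
    independent modulo the identity, [H] has the symmetry of the diagonal half-turns.
    When [c3] is proportional to the nonzero deviator [p] of [d2], write [n] for the
    direction orthogonal to [p] and [(1, 1, 1)]: then [H_23ii], [H_13ii], [H_12ii] are
    multiples [s_i n], and the equations [d2_ij = 0] force either [s = 0], or some
    [n_i = 0], where [H] is invariant under a rotation of order 3 or 4. When [d2] is
    scalar, a critical point of [H(x, x, x, x)] on the sphere, taken as [e3], kills
    [H_1333] and [H_2333], and the equations [d2_ij = 0] produce the symmetries. *)

(** * Equivariance of the covariants *)

Definition i0 : 'I_3 := @Ordinal 3 0 isT.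
Definition i1 : 'I_3 := @Ordinal 3 1 isT.
Definition i2 : 'I_3 := @Ordinal 3 2 isT.

Lemma ord3_ind (P : 'I_3 -> Prop) : P i0 -> P i1 -> P i2 -> forall i, P i.
Proof.
move=> P0 P1 P2 [[|[|[|//]]] lt_i3].
- by rewrite (_ : Ordinal _ = i0) //; apply: val_inj.
- by rewrite (_ : Ordinal _ = i1) //; apply: val_inj.
- by rewrite (_ : Ordinal _ = i2) //; apply: val_inj.
Qed.

Lemma sum3 (V : nmodType) (F : 'I_3 -> V) :
  \sum_(i < 3) F i = F i0 + F i1 + F i2.
Proof.
rewrite !big_ord_recl big_ord0 addr0 addrA.
by congr (F _ + F _ + F _); apply: val_inj.
Qed.

Section Equivariance.
Variable R : realType.
Implicit Types (g h : 'M[R]_3) (T : tensor4 R).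

(** The action on a tensor becomes a nest of one-index actions, so equivariance proofs only swap,
    merge and contract single factors. *)
Definition app g (f : 'I_3 -> R) : 'I_3 -> R := fun i => \sum_(a < 3) g i a * f a.

Lemma app_swap g h (F : 'I_3 -> 'I_3 -> R) i j :
  app g (fun a => app h (F a) j) i = app h (fun b => app g (F^~ b) i) j.
Proof.
rewrite /app; under eq_bigr do rewrite mulr_sumr.
rewrite exchange_big /=; apply: eq_bigr => b _; rewrite mulr_sumr.
by apply: eq_bigr => a _; rewrite mulrCA.
Qed.

Lemma app_mul g h f i : app g (app h f) i = app (g *m h) f i.
Proof.
rewrite /app; under eq_bigr do rewrite mulr_sumr.
rewrite exchange_big /=; apply: eq_bigr => b _; rewrite mxE mulr_suml.
by apply: eq_bigr => a _; rewrite mulrA.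
Qed.

Lemma app1 f i : app 1%:M f i = f i.
Proof.
rewrite /app (bigD1 i) //= mxE eqxx mul1r big1 ?addr0 // => j ne_ji.
by rewrite mxE eq_sym (negPf ne_ji) mul0r.
Qed.

Lemma app_sum g (F : 'I_3 -> 'I_3 -> R) i :
  \sum_(m < 3) app g (F m) i = app g (fun a => \sum_(m < 3) F m a) i.
Proof.
rewrite /app exchange_big /=; apply: eq_bigr => a _.
by rewrite mulr_sumr.
Qed.

Lemma app_mulr g f x i : app g f i * x = app g (fun a => f a * x) i.
Proof. by rewrite /app mulr_suml; apply: eq_bigr => a _; rewrite mulrA. Qed.

Lemma app_mull g f x i : x * app g f i = app g (fun a => x * f a) i.
Proof. by rewrite mulrC app_mulr; apply: eq_bigr => a _; rewrite [f a * x]mulrC. Qed.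

Lemma eq_app g f f' i : f =1 f' -> app g f i = app g f' i.
Proof. by move=> eq_f; apply: eq_bigr => a _; rewrite eq_f. Qed.

Lemma SO3_trmulmx g : SO3 g -> g^T *m g = 1%:M.
Proof. by case=> /mulmx1C. Qed.

Lemma SO3_1 : SO3 (1%:M : 'M[R]_3).
Proof. by split; rewrite ?trmx1 ?mulmx1 ?det1. Qed.

Lemma SO3_tr g : SO3 g -> SO3 g^T.
Proof. by move=> g_SO; split; rewrite ?trmxK ?SO3_trmulmx // det_tr; case: g_SO. Qed.

Lemma SO3_mul g h : SO3 g -> SO3 h -> SO3 (g *m h).
Proof.
move=> [gg dg] [hh dh]; split; last by rewrite det_mulmx dg dh mulr1.
by rewrite trmx_mul mulmxA -[g *m h *m _]mulmxA hh mulmx1.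
Qed.

Lemma app_contract g (X Y : 'I_3 -> R) : SO3 g ->
  \sum_(m < 3) app g X m * app g Y m = \sum_(m < 3) X m * Y m.
Proof.
move=> /SO3_trmulmx gg; transitivity (\sum_(m < 3) X m * app (g^T *m g) Y m).
  under [RHS]eq_bigr do rewrite -app_mul {1}/app mulr_sumr.
  rewrite exchange_big /=; apply: eq_bigr => m _; rewrite mulr_suml.
  by apply: eq_bigr => a _; rewrite mxE mulrCA mulrA.
by rewrite gg; apply: eq_bigr => m _; rewrite app1.
Qed.

Lemma app_trace g (F : 'I_3 -> 'I_3 -> R) : SO3 g ->
  \sum_(m < 3) app g (fun a => app g (F a) m) m = \sum_(a < 3) F a a.
Proof.
move=> /SO3_trmulmx gg.
transitivity (\sum_(b < 3) app (g^T *m g) (F^~ b) b).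
  under [RHS]eq_bigr do rewrite -app_mul {1}/app.
  rewrite [RHS]exchange_big /=; apply: eq_bigr => m _.
  by rewrite app_swap; apply: eq_bigr => b _; rewrite mxE.
by rewrite gg; apply: eq_bigr => b _; rewrite app1.
Qed.

Lemma act4E g T i j k l : act4 g T i j k l =
  app g (fun a => app g (fun b => app g (fun c => app g (T a b c) l) k) j) i.
Proof.
rewrite /act4 /app; apply: eq_bigr => a _; rewrite mulr_sumr.
apply: eq_bigr => b _; rewrite !mulr_sumr; apply: eq_bigr => c _.
by rewrite !mulr_sumr; apply: eq_bigr => d _; rewrite !mulrA.
Qed.

Lemma act2E g (a : 'M[R]_3) i j : act2 g a i j = app g (fun x => app g (a x) j) i.
Proof.
rewrite app_swap /act2 mxE; apply: eq_bigr => y _.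
by rewrite !mxE mulrC; congr (_ * _); apply: eq_bigr.
Qed.

Lemma act4M g h T : act4 g (act4 h T) = act4 (g *m h) T.
Proof.
apply/funext => i; apply/funext => j; apply/funext => m; apply/funext => n.
rewrite !act4E.
transitivity (app g (fun a => app g (fun b => app g (fun c => app h (fun x =>
    app h (fun y => app h (fun z => app (g *m h) (T x y z) n) c) b) a) m) j) i).
  apply: eq_app => a; apply: eq_app => b; apply: eq_app => c.
  transitivity (app g (fun d => app h (fun x => app h (fun y => app h (fun z =>
    app h (T x y z) d) c) b) a) n).
    by apply: eq_app => d; rewrite act4E.
  rewrite app_swap; apply: eq_app => x; rewrite app_swap; apply: eq_app => y.
  by rewrite app_swap; apply: eq_app => z; rewrite app_mul.
transitivity (app g (fun a => app g (fun b => app h (fun x =>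
    app h (fun y => app (g *m h) (fun z => app (g *m h) (T x y z) n) m) b) a) j) i).
  apply: eq_app => a; apply: eq_app => b.
  rewrite app_swap; apply: eq_app => x; rewrite app_swap; apply: eq_app => y.
  by rewrite app_mul.
rewrite -[RHS]app_mul; apply: eq_app => a.
rewrite app_swap; apply: eq_app => x; exact: app_mul.
Qed.

Lemma act4_1 T : act4 1%:M T = T.
Proof.
apply/funext => i; apply/funext => j; apply/funext => m; apply/funext => l.
by rewrite act4E !app1.
Qed.

Lemma act2M g h (a : 'M[R]_3) : act2 g (act2 h a) = act2 (g *m h) a.
Proof. by rewrite /act2 trmx_mul !mulmxA. Qed.

Lemma in_H4_of_trace T : totally_symmetric4 T ->
  (forall k l, \sum_(m < 3) T m m k l = 0) -> in_H4 T.
Proof.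
move=> symT tr12; split=> // i j k l; split=> //.
have s12 a b c d : T a b c d = T b a c d by have [] := symT a b c d.
have s23 a b c d : T a b c d = T a c b d by have [_ []] := symT a b c d.
have s34 a b c d : T a b c d = T a b d c by have [_ []] := symT a b c d.
have tr23 x y : \sum_(m < 3) T x m m y = 0.
  by rewrite -[RHS](tr12 x y); apply: eq_bigr => m _; rewrite s12 s23.
have tr13 x y : \sum_(m < 3) T m x m y = 0.
  by rewrite -[RHS](tr23 x y); apply: eq_bigr => m _; rewrite s12.
have tr24 x y : \sum_(m < 3) T x m y m = 0.
  by rewrite -[RHS](tr23 x y); apply: eq_bigr => m _; rewrite s34.
have tr14 x y : \sum_(m < 3) T m x y m = 0.
  by rewrite -[RHS](tr24 x y); apply: eq_bigr => m _; rewrite s12.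
have tr34 x y : \sum_(m < 3) T x y m m = 0.
  by rewrite -[RHS](tr24 x y); apply: eq_bigr => m _; rewrite s23.
by [].
Qed.

Lemma act4_in_H4 g T : SO3 g -> in_H4 T -> in_H4 (act4 g T).
Proof.
move=> g_SO [symT trT].
have s12 i j k l : act4 g T i j k l = act4 g T j i k l.
  rewrite !act4E app_swap; apply: eq_app => a; apply: eq_app => b.
  by apply: eq_app => c; apply: eq_app => d; have [] := symT b a c d.
have s23 i j k l : act4 g T i j k l = act4 g T i k j l.
  rewrite !act4E; apply: eq_app => a; rewrite app_swap; apply: eq_app => b.
  by apply: eq_app => c; apply: eq_app => d; have [_ []] := symT a c b d.
have s34 i j k l : act4 g T i j k l = act4 g T i j l k.
  rewrite !act4E; apply: eq_app => a; apply: eq_app => b; rewrite app_swap.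
  by apply: eq_app => c; apply: eq_app => d; have [_ []] := symT a b d c.
have tr12 k l : \sum_(m < 3) act4 g T m m k l = 0.
  under eq_bigr do rewrite act4E.
  rewrite app_trace // app_sum /app big1 // => a _.
  rewrite app_sum /app big1 ?mulr0 // => b _.
  by have [-> _] := trT a a a b; rewrite mulr0.
by apply: in_H4_of_trace => // i j k l.
Qed.

(** Total symmetry moves the three summed index pairs into matching slots; symmetry of [d2] is then
    commutativity, and its equivariance is orthogonality applied to each pair. *)
Lemma d2_sym_form T i j : in_H4 T ->
  d2 T i j = \sum_(k < 3) \sum_(m < 3) \sum_(n < 3) T i k m n * T j k m n.
Proof.
case=> symT _; rewrite /d2 /tr13 mxE; apply: eq_bigr => k _.
apply: eq_bigr => m _; apply: eq_bigr => n _.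
have s12 a b c d : T a b c d = T b a c d by have [] := symT a b c d.
have s23 a b c d : T a b c d = T a c b d by have [_ []] := symT a b c d.
have s34 a b c d : T a b c d = T a b d c by have [_ []] := symT a b c d.
congr (_ * _); first exact: s12.
by rewrite (s34 m n k j) (s23 m n j k) (s12 m j n k) (s34 j m n k).
Qed.

Lemma app_contract3 g (F G : 'I_3 -> 'I_3 -> 'I_3 -> R) : SO3 g ->
  \sum_(k < 3) \sum_(m < 3) \sum_(n < 3)
    app g (fun b => app g (fun c => app g (F b c) n) m) k *
    app g (fun b => app g (fun c => app g (G b c) n) m) k =
  \sum_(k < 3) \sum_(m < 3) \sum_(n < 3) F k m n * G k m n.
Proof.
move=> g_SO.
have step (X Y : 'I_3 -> 'I_3 -> R) :
    \sum_(m < 3) \sum_(n < 3) app g (fun c => app g (X c) n) m *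
      app g (fun c => app g (Y c) n) m =
    \sum_(m < 3) \sum_(n < 3) X m n * Y m n.
  rewrite exchange_big /=.
  under eq_bigr do rewrite app_contract //.
  by rewrite exchange_big; apply: eq_bigr => m _; rewrite app_contract.
transitivity (\sum_(m < 3) \sum_(n < 3) \sum_(k < 3)
    app g (fun c => app g (F k c) n) m * app g (fun c => app g (G k c) n) m).
  rewrite exchange_big /=; apply: eq_bigr => m _.
  by rewrite exchange_big /=; apply: eq_bigr => n _; rewrite app_contract.
under eq_bigr do rewrite exchange_big /=.
by rewrite exchange_big /=; apply: eq_bigr => k _; rewrite step.
Qed.

Lemma d2_equiv g T : SO3 g -> in_H4 T -> d2 (act4 g T) = act2 g (d2 T).
Proof.
move=> g_SO T_H4; apply/matrixP => i j.
rewrite d2_sym_form; last exact: act4_in_H4.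
pose F x b c d := app g (fun a => T a b c d) x.
have actF x k m n : act4 g T x k m n =
    app g (fun b => app g (fun c => app g (F x b c) n) m) k.
  rewrite act4E app_swap; apply: eq_app => b; rewrite app_swap.
  by apply: eq_app => c; rewrite app_swap.
under eq_bigr do under eq_bigr do under eq_bigr do rewrite !actF.
rewrite app_contract3 // act2E.
transitivity (app g (fun x => app g (fun y =>
    \sum_(k < 3) \sum_(m < 3) \sum_(n < 3) T x k m n * T y k m n) j) i); last first.
  by apply: eq_app => x; apply: eq_app => y; rewrite d2_sym_form.
have sumA (X : 'I_3 -> 'I_3 -> 'I_3 -> R) f x :
    (forall k, \sum_(m < 3) \sum_(n < 3) X k m n = app g (f k) x) ->
    \sum_(k < 3) \sum_(m < 3) \sum_(n < 3) X k m n = app g (fun a => \sum_(k < 3) f k a) x.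
  by move=> XE; under eq_bigr do rewrite XE; rewrite app_sum.
rewrite (sumA _ (fun k a => \sum_(m < 3) \sum_(n < 3) T a k m n * F j k m n) i).
  apply: eq_app => x; symmetry.
  rewrite -app_sum; apply: eq_bigr => k _; rewrite -app_sum; apply: eq_bigr => m _.
  by rewrite -app_sum; apply: eq_bigr => n _; rewrite -app_mull.
move=> k; rewrite -app_sum; apply: eq_bigr => m _.
by rewrite -app_sum; apply: eq_bigr => n _; rewrite -app_mulr.
Qed.

Lemma dcontr42_equiv g T (a : 'M[R]_3) : SO3 g ->
  dcontr42 (act4 g T) (act2 g a) = act2 g (dcontr42 T a).
Proof.
move=> g_SO; apply/matrixP => i j; rewrite act2E mxE.
(* [F] absorbs the action on the two free indices; the action on the contracted pair cancels by
   orthogonality. *)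
pose F c d := app g (fun x => app g (fun y => T x y c d) j) i.
have actF k l : act4 g T i j k l = app g (fun c => app g (F c) l) k.
  rewrite act4E /F.
  transitivity (app g (fun x => app g (fun c => app g (fun y => app g (T x y c) l) j) k) i).
    by apply: eq_app => x; rewrite app_swap.
  rewrite app_swap; apply: eq_app => c.
  transitivity (app g (fun x => app g (fun d => app g (fun y => T x y c d) j) l) i).
    by apply: eq_app => x; rewrite app_swap.
  by rewrite app_swap.
under eq_bigr do under eq_bigr do rewrite actF act2E.
rewrite exchange_big /=.
transitivity (\sum_(l < 3) \sum_(k < 3) app g (F k) l * app g (a k) l).
  by apply: eq_bigr => l _; rewrite app_contract.
rewrite exchange_big /=.
transitivity (\sum_(k < 3) \sum_(l < 3) F k l * a k l).
  by apply: eq_bigr => k _; rewrite app_contract.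
symmetry; transitivity (app g (fun x => \sum_(k < 3) \sum_(l < 3)
    app g (fun y => T x y k l) j * a k l) i).
  apply: eq_app => x; transitivity (app g (fun y => \sum_(k < 3) \sum_(l < 3)
    T x y k l * a k l) j); first by apply: eq_app => y; rewrite mxE.
  rewrite -app_sum; apply: eq_bigr => k _; rewrite -app_sum.
  by apply: eq_bigr => l _; rewrite -app_mulr.
rewrite -app_sum; apply: eq_bigr => k _; rewrite -app_sum.
by apply: eq_bigr => l _; rewrite -app_mulr.
Qed.

Lemma c3_equiv g T : SO3 g -> in_H4 T -> c3 (act4 g T) = act2 g (c3 T).
Proof. by move=> g_SO T_H4; rewrite /c3 d2_equiv // dcontr42_equiv. Qed.

Lemma c4_equiv g T : SO3 g -> in_H4 T -> c4 (act4 g T) = act2 g (c4 T).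
Proof. by move=> g_SO T_H4; rewrite /c4 c3_equiv // dcontr42_equiv. Qed.

Lemma polyfun4_sum (F : 'I_3 -> tensor4 R -> R) :
  (forall i, polyfun4 (F i)) -> polyfun4 (fun T => \sum_(i < 3) F i T).
Proof.
move=> pF; rewrite (_ : (fun T => _) = fun T => F i0 T + F i1 T + F i2 T).
  by apply: pf_add => //; apply: pf_add.
by apply/funext => T; rewrite sum3.
Qed.

Lemma polyfun4_d2 i j : polyfun4 (fun T : tensor4 R => d2 T i j).
Proof.
rewrite (_ : (fun T => _) = fun T => \sum_(k < 3) \sum_(m < 3) \sum_(n < 3)
  T k i m n * T m n k j); last by apply/funext => T; rewrite mxE.
do 3!apply: polyfun4_sum => ?; apply: pf_mul; exact: pf_coord.
Qed.

Lemma polyfun4_dcontr42 (f : tensor4 R -> 'M[R]_3) :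
  (forall i j, polyfun4 (fun T => f T i j)) ->
  forall i j, polyfun4 (fun T => dcontr42 T (f T) i j).
Proof.
move=> pf i j; rewrite (_ : (fun T => _) = fun T => \sum_(k < 3) \sum_(l < 3)
  T i j k l * f T k l); last by apply/funext => T; rewrite mxE.
do 2!apply: polyfun4_sum => ?; apply: pf_mul => //; exact: pf_coord.
Qed.

Lemma d2_sym T : in_H4 T -> is_sym2 (d2 T).
Proof.
move=> T_H4; apply/matrixP => i j; rewrite mxE !d2_sym_form //.
by do 3!apply: eq_bigr => ? _; rewrite mulrC.
Qed.

Lemma dcontr42_sym T (a : 'M[R]_3) : in_H4 T -> is_sym2 (dcontr42 T a).
Proof.
move=> [symT _]; apply/matrixP => i j; rewrite !mxE.
apply: eq_bigr => k _; apply: eq_bigr => l _.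
by congr (_ * _); have [] := symT j i k l.
Qed.

(** This gives the second inclusion between symmetry groups: a larger family has a smaller symmetry
    group. *)
Lemma triple_sub_Cov2 T (a : 'M[R]_3) : in_H4 T -> triple T a -> Cov2 T a.
Proof.
have pd3 := polyfun4_dcontr42 polyfun4_d2.
have pd4 := polyfun4_dcontr42 pd3.
have pfE f : (forall i j, polyfun4 (fun T => f T i j)) -> forall i j : 'I_3,
    exists p, polyfun4 p /\ forall T, in_H4 T -> f T i j = p T.
  by move=> pf i j; exists (fun T => f T i j).
move=> T_H4 [->|[->|->]].
- exists (@d2 R); split=> //; split; first exact: (pfE _ polyfun4_d2).
  by split=> [S S_H4|g S g_SO S_H4]; [apply: d2_sym|apply: d2_equiv].
- exists (@c3 R); split=> //; split; first exact: (pfE _ pd3).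
  by split=> [S S_H4|g S g_SO S_H4]; [apply: dcontr42_sym|apply: c3_equiv].
- exists (@c4 R); split=> //; split; first exact: (pfE _ pd4).
  by split=> [S S_H4|g S g_SO S_H4]; [apply: dcontr42_sym|apply: c4_equiv].
Qed.

Lemma symgroup4P T g : symgroup4 T g <-> SO3 g /\ act4 g T = T.
Proof.
split=> -[g_SO gT]; split=> //; last by rewrite gT.
by do 4!apply/funext => ?; apply: gT.
Qed.

Lemma symgroup4_sub_Cov2 T g : in_H4 T ->
  symgroup4 T g -> symgroup_family2 (Cov2 T) g.
Proof.
move=> T_H4 /symgroup4P[g_SO gT]; split=> // _ [f [[_ [_ f_equiv]] ->]].
by rewrite -f_equiv // gT.
Qed.

Lemma symgroup_Cov2_sub_triple T g : in_H4 T ->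
  symgroup_family2 (Cov2 T) g -> symgroup_family2 (triple T) g.
Proof.
by move=> T_H4 [g_SO gC]; split=> // a aT; apply: gC; apply: triple_sub_Cov2.
Qed.

Lemma symgroup4_conj T g h : SO3 h ->
  symgroup4 (act4 h T) g -> symgroup4 T (h^T *m g *m h).
Proof.
move=> h_SO /symgroup4P[g_SO gT]; apply/symgroup4P; split.
  by do 2?apply: SO3_mul => //; apply: SO3_tr.
by rewrite -!act4M gT act4M SO3_trmulmx // act4_1.
Qed.

Lemma symgroup_triple_conj T g h : in_H4 T -> SO3 h ->
  symgroup_family2 (triple T) g ->
  symgroup_family2 (triple (act4 h T)) (h *m g *m h^T).
Proof.
move=> T_H4 h_SO [g_SO gT]; split.
  by do 2?apply: SO3_mul => //; apply: SO3_tr.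
have key a : act2 g a = a -> act2 (h *m g *m h^T) (act2 h a) = act2 h a.
  move=> ga; rewrite act2M -mulmxA SO3_trmulmx // mulmx1 -act2M.
  by rewrite ga.
move=> a; rewrite /triple d2_equiv // c3_equiv // c4_equiv //.
by case=> [|[]] ->; apply: key; apply: gT; [left|right; left|right; right].
Qed.
End Equivariance.

(** * Coordinates on harmonic tensors *)

Section Harmonic.
Variable R : realType.
Implicit Types (h a b A B D E : R).

(* The components depend only on the multiplicities of the first two index values;
   [h1], [h2], [h3] are the components (2233), (1133), (1122) in the usual numbering,
   and [a], [b], [A], [B], [D], [E] are (1112), (1222), (1113), (1223), (1123), (2223). *)
Definition harm h1 h2 h3 a b A B D E : tensor4 R := fun i j k l =>
  let mult v := ((i == v :> nat) + (j == v :> nat) + (k == v :> nat) + (l == v :> nat))%N in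
  match mult 0%N, mult 1%N with
  | 4, _ => - (h2 + h3)
  | 0, 4 => - (h1 + h3)
  | 0, 0 => - (h1 + h2)
  | 0, 2 => h1
  | 2, 0 => h2
  | 2, 2 => h3
  | 3, 1 => a
  | 1, 3 => b
  | 1, 1 => - (a + b)
  | 3, 0 => A
  | 1, 2 => B
  | 1, 0 => - (A + B)
  | 2, 1 => D
  | 0, 3 => E
  | 0, 1 => - (D + E)
  | _, _ => 0
  end.

Lemma harm_in_H4 h1 h2 h3 a b A B D E : in_H4 (harm h1 h2 h3 a b A B D E).
Proof.
apply: in_H4_of_trace; first by do 4!elim/ord3_ind.
by do 2!elim/ord3_ind; rewrite sum3 /harm /=; ring.
Qed.

Lemma harmE (T : tensor4 R) : in_H4 T ->
  T = harm (T i1 i1 i2 i2) (T i0 i0 i2 i2) (T i0 i0 i1 i1)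
           (T i0 i0 i0 i1) (T i0 i1 i1 i1) (T i0 i0 i0 i2)
           (T i0 i1 i1 i2) (T i0 i0 i1 i2) (T i1 i1 i1 i2).
Proof.
move=> [symT trT].
have s12 (a b c d : 'I_3) : T a b c d = T b a c d by have [] := symT a b c d.
have s23 (a b c d : 'I_3) : T a b c d = T a c b d by have [_ []] := symT a b c d.
have s34 (a b c d : 'I_3) : T a b c d = T a b d c by have [_ []] := symT a b c d.
have tr k l : T i0 i0 k l + T i1 i1 k l + T i2 i2 k l = 0.
  by have [<- _] := trT k k k l; rewrite sum3.
(* Each rule swaps an adjacent decreasing pair of indices, so rewriting terminates with sorted
   quadruples; the six trace equations then reduce fifteen components to nine. *)
have sort := (s12 i1 i0, s12 i2 i0, s12 i2 i1, (fun a : 'I_3 => s23 a i1 i0),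
  (fun a : 'I_3 => s23 a i2 i0), (fun a : 'I_3 => s23 a i2 i1), (fun a b : 'I_3 => s34 a b i1 i0),
  (fun a b : 'I_3 => s34 a b i2 i0), (fun a b : 'I_3 => s34 a b i2 i1)).
have := (tr i0 i0, tr i0 i1, tr i0 i2, tr i1 i1, tr i1 i2, tr i2 i2).
rewrite !sort => -[[[[[t00 t01] t02] t11] t12] t22].
apply/funext => i; apply/funext => j; apply/funext => k; apply/funext => l.
move: i j k l; do 4!elim/ord3_ind; rewrite ?sort /harm //=; lra.
Qed.
End Harmonic.

(** * Action of particular rotations in the harmonic coordinates *)

Section Rotations.
Variable R : realType.
Implicit Types (g : 'M[R]_3) (T : tensor4 R) (h a b A B D E c s : R).

Lemma matrix3P (M N : 'M[R]_3) :
  M i0 i0 = N i0 i0 -> M i0 i1 = N i0 i1 -> M i0 i2 = N i0 i2 ->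
  M i1 i0 = N i1 i0 -> M i1 i1 = N i1 i1 -> M i1 i2 = N i1 i2 ->
  M i2 i0 = N i2 i0 -> M i2 i1 = N i2 i1 -> M i2 i2 = N i2 i2 -> M = N.
Proof. by move=> *; apply/matrixP; do 2!elim/ord3_ind. Qed.

Lemma det3 (M : 'M[R]_3) : \det M =
  M i0 i0 * (M i1 i1 * M i2 i2 - M i1 i2 * M i2 i1) -
  M i0 i1 * (M i1 i0 * M i2 i2 - M i1 i2 * M i2 i0) +
  M i0 i2 * (M i1 i0 * M i2 i1 - M i1 i1 * M i2 i0).
Proof.
(* Reading entries through natural numbers lets the lifted indices of the nested cofactor expansions
   compute. *)
pose F (i j : nat) := M (inord i) (inord j).
have MF i j : M i j = F i j by rewrite /F !inord_val.
rewrite (expand_det_row _ i0) sum3 /cofactor !(expand_det_row _ ord0).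
rewrite !big_ord_recl !big_ord0 /cofactor !det_mx11 !mxE /= !MF /= /bump /=.
ring.
Qed.

Definition mx3 (x00 x01 x02 x10 x11 x12 x20 x21 x22 : R) : 'M[R]_3 :=
  \matrix_(i, j) match nat_of_ord i, nat_of_ord j with
    | 0, 0 => x00 | 0, 1 => x01 | 0, _ => x02
    | 1, 0 => x10 | 1, 1 => x11 | 1, _ => x12
    | _, 0 => x20 | _, 1 => x21 | _, _ => x22
    end.

Definition rotz c s := mx3 c (- s) 0 s c 0 0 0 1.
(** Transfers a statement proved for one coordinate axis to the other two. *)
Definition cyc := mx3 0 1 0 0 0 1 1 0 0.

Lemma rotz_SO3 c s : c ^+ 2 + s ^+ 2 = 1 -> SO3 (rotz c s).
Proof.
move=> cs1; have c2 : c ^+ 2 = 1 - s ^+ 2 by rewrite -cs1; ring.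
split; last by rewrite det3 !mxE /=; ring: c2.
by apply: matrix3P; rewrite mxE sum3 !mxE /=; ring: c2.
Qed.

Lemma cyc_SO3 : SO3 cyc.
Proof.
split; last by rewrite det3 !mxE /=; ring.
by apply: matrix3P; rewrite mxE sum3 !mxE /=; ring.
Qed.

Definition rot1 := mx3 1 0 0 0 (-1) 0 0 0 (-1) : 'M[R]_3.
Definition rot2 := mx3 (-1) 0 0 0 1 0 0 0 (-1) : 'M[R]_3.

Lemma rot1_SO3 : SO3 rot1.
Proof.
split; last by rewrite det3 !mxE /=; ring.
by apply: matrix3P; rewrite mxE sum3 !mxE /=; ring.
Qed.

Lemma rot2_SO3 : SO3 rot2.
Proof.
split; last by rewrite det3 !mxE /=; ring.
by apply: matrix3P; rewrite mxE sum3 !mxE /=; ring.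
Qed.

Lemma rot_pi_e3E : rot_pi_e3 R = rotz (-1) 0.
Proof. by apply: matrix3P; rewrite !mxE //= oppr0. Qed.

Lemma act4_harmE g T : SO3 g -> in_H4 T -> act4 g T =
  harm (act4 g T i1 i1 i2 i2) (act4 g T i0 i0 i2 i2) (act4 g T i0 i0 i1 i1)
       (act4 g T i0 i0 i0 i1) (act4 g T i0 i1 i1 i1) (act4 g T i0 i0 i0 i2)
       (act4 g T i0 i1 i1 i2) (act4 g T i0 i0 i1 i2) (act4 g T i1 i1 i1 i2).
Proof. by move=> g_SO T_H4; apply: harmE; apply: act4_in_H4. Qed.

Lemma app_mx3 x00 x01 x02 x10 x11 x12 x20 x21 x22 (f : 'I_3 -> R) :
  [/\ app (mx3 x00 x01 x02 x10 x11 x12 x20 x21 x22) f i0 = x00 * f i0 + x01 * f i1 + x02 * f i2,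
      app (mx3 x00 x01 x02 x10 x11 x12 x20 x21 x22) f i1 = x10 * f i0 + x11 * f i1 + x12 * f i2
    & app (mx3 x00 x01 x02 x10 x11 x12 x20 x21 x22) f i2 = x20 * f i0 + x21 * f i1 + x22 * f i2].
Proof. by split; rewrite /app sum3 !mxE. Qed.

Lemma app_rotz0 c s f : app (rotz c s) f i0 = c * f i0 - s * f i1.
Proof. by have [-> _ _] := app_mx3 c (- s) 0 s c 0 0 0 1 f; ring. Qed.

Lemma app_rotz1 c s f : app (rotz c s) f i1 = s * f i0 + c * f i1.
Proof. by have [_ -> _] := app_mx3 c (- s) 0 s c 0 0 0 1 f; ring. Qed.

Lemma app_rotz2 c s f : app (rotz c s) f i2 = f i2.
Proof. by have [_ _ ->] := app_mx3 c (- s) 0 s c 0 0 0 1 f; ring. Qed.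

Definition app_rotz := (app_rotz0, app_rotz1, app_rotz2).

Lemma app_cyc f : [/\ app cyc f i0 = f i1, app cyc f i1 = f i2 & app cyc f i2 = f i0].
Proof. by have [-> -> ->] := app_mx3 0 1 0 0 0 1 1 0 0 f; split; ring. Qed.

Lemma act4_cyc h1 h2 h3 a b A B D E :
  act4 cyc (harm h1 h2 h3 a b A B D E) =
  harm h2 h3 h1 E (- (D + E)) b (- (a + b)) B (- (A + B)).
Proof.
have c0 f : app cyc f i0 = f i1 by have [] := app_cyc f.
have c1 f : app cyc f i1 = f i2 by have [] := app_cyc f.
have c2 f : app cyc f i2 = f i0 by have [] := app_cyc f.
rewrite act4_harmE; [|exact: cyc_SO3|exact: harm_in_H4].
by rewrite !act4E !(c0, c1, c2).
Qed.

Lemma act4_rot1 h1 h2 h3 a b A B D E :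
  act4 rot1 (harm h1 h2 h3 a b A B D E) =
  harm h1 h2 h3 (- a) (- b) (- A) (- B) D E.
Proof.
have c0 f : app rot1 f i0 = f i0.
  by have [-> _ _] := app_mx3 1 0 0 0 (-1) 0 0 0 (-1) f; ring.
have c1 f : app rot1 f i1 = - f i1.
  by have [_ -> _] := app_mx3 1 0 0 0 (-1) 0 0 0 (-1) f; ring.
have c2 f : app rot1 f i2 = - f i2.
  by have [_ _ ->] := app_mx3 1 0 0 0 (-1) 0 0 0 (-1) f; ring.
rewrite act4_harmE; [|exact: rot1_SO3|exact: harm_in_H4].
by rewrite !act4E !(c0, c1, c2) !opprK.
Qed.

Lemma act4_rot2 h1 h2 h3 a b A B D E :
  act4 rot2 (harm h1 h2 h3 a b A B D E) =
  harm h1 h2 h3 (- a) (- b) A B (- D) (- E).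
Proof.
have c0 f : app rot2 f i0 = - f i0.
  by have [-> _ _] := app_mx3 (-1) 0 0 0 1 0 0 0 (-1) f; ring.
have c1 f : app rot2 f i1 = f i1.
  by have [_ -> _] := app_mx3 (-1) 0 0 0 1 0 0 0 (-1) f; ring.
have c2 f : app rot2 f i2 = - f i2.
  by have [_ _ ->] := app_mx3 (-1) 0 0 0 1 0 0 0 (-1) f; ring.
rewrite act4_harmE; [|exact: rot2_SO3|exact: harm_in_H4].
by rewrite !act4E !(c0, c1, c2) !opprK.
Qed.

Lemma act4_rot_pi_e3 h1 h2 h3 a b A B D E :
  act4 (rot_pi_e3 R) (harm h1 h2 h3 a b A B D E) =
  harm h1 h2 h3 a b (- A) (- B) (- D) (- E).
Proof.
rewrite rot_pi_e3E act4_harmE; [|by apply: rotz_SO3; ring|exact: harm_in_H4].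
by rewrite !act4E !app_rotz /harm /=; congr harm; ring.
Qed.

(** Around the third axis, [H_1133 - H_2233] and [H_1233] have angular weight 2 and the odd part has
    weights 1 and 3. Without them only weights 0 and 4 remain, and a quarter turn fixes these. *)
Lemma act4_rotz_quarter h1 h3 a :
  let T := harm h1 h1 h3 a (- a) 0 0 0 0 in act4 (rotz 0 1) T = T.
Proof.
rewrite /= act4_harmE; [|by apply: rotz_SO3; ring|exact: harm_in_H4].
by rewrite !act4E !app_rotz /harm /=; congr harm; ring.
Qed.

(** Only angular weights 0 and 3 occur: [(-4h, -4h, h)] is the zonal part, and [B = -A], [E = -D]
    remove weight 1. *)
Lemma act4_rotz_third s h A D : 4 * s ^+ 2 = 3 ->
  let T := harm (- 4 * h) (- 4 * h) h 0 0 A (- A) D (- D) in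
  act4 (rotz (- 2^-1) s) T = T.
Proof.
move=> s3 /=; have s2 : s ^+ 2 = 3 / 4 by lra.
(* These rules lower the powers of [s], so that the expanded components become linear problems for
   [lra]. *)
have p2 x : x * s ^+ 2 = 3 / 4 * x by rewrite s2 mulrC.
have p3 x : x * s ^+ 3 = 3 / 4 * (x * s) by rewrite exprS s2; ring.
have p4 x : x * s ^+ 4 = 9 / 16 * x.
  by rewrite -[4%N]/(2 * 2)%N exprM s2; field.
have := (p2 h, p3 h, p4 h, p2 A, p3 A, p4 A, p2 D, p3 D, p4 D).
move=> [[[[[[[[h_2 h_3] h_4] A_2] A_3] A_4] D_2] D_3] D_4].
rewrite act4_harmE; [|by apply: rotz_SO3; rewrite s2; field|exact: harm_in_H4].
by rewrite !act4E !app_rotz /harm /=; congr harm; lra.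
Qed.
End Rotations.

(** * Harmonic tensors with a large symmetry group *)

Section BigGroups.
Variable R : realType.
Implicit Types (g : 'M[R]_3) (T : tensor4 R) (h a b A B D E c s x y z : R).

(** An obstruction to class [[Z_2]] that passes to larger groups, so that proving it for the group
    of [H] settles all three groups at once. *)
Definition big_group (G : 'M[R]_3 -> Prop) :=
  exists g h : 'M[R]_3, [/\ G g, G h, g <> 1%:M, h <> 1%:M & g <> h].

Lemma big_group_sub (G G' : 'M[R]_3 -> Prop) :
  (forall g, G g -> G' g) -> big_group G -> big_group G'.
Proof. by move=> sGG' [g [h [/sGG' ? /sGG' ? ? ? ?]]]; exists g, h. Qed.

Lemma big_group_not_Z2 (G : 'M[R]_3 -> Prop) : big_group G -> ~ in_class_Z2 G.
Proof.
move=> [g [h [Gg Gh g1 h1 gh]]] [k [[kk _] GE]].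
have inG f : G f -> f = 1%:M \/ f = k *m rot_pi_e3 R *m k^T.
  case/GE=> f' [[->|->] ->]; last by right.
  by left; rewrite mulmx1.
by case: (inG _ Gg) (inG _ Gh) => [//|eq_g] [//|eq_h]; apply: gh; rewrite eq_g.
Qed.

Lemma big_group_act4 g T : SO3 g ->
  big_group (symgroup4 (act4 g T)) -> big_group (symgroup4 T).
Proof.
move=> g_SO [f [h [Gf Gh f1 h1 fh]]].
have [gg _] := g_SO; have gg' := SO3_trmulmx g_SO.
have conjK f' : g *m (g^T *m f' *m g) *m g^T = f'.
  by rewrite !mulmxA gg mul1mx -mulmxA gg mulmx1.
exists (g^T *m f *m g), (g^T *m h *m g); split; try exact: symgroup4_conj.
- by move=> e; apply: f1; rewrite -(conjK f) e mulmx1.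
- by move=> e; apply: h1; rewrite -(conjK h) e mulmx1.
- by move=> e; apply: fh; rewrite -(conjK f) e conjK.
Qed.

Lemma entry_neq (M N : 'M[R]_3) i j : M i j != N i j -> M <> N.
Proof. by move=> neq eqMN; rewrite eqMN eqxx in neq. Qed.

Lemma big_diag h1 h2 h3 : big_group (symgroup4 (harm h1 h2 h3 0 0 0 0 0 0)).
Proof.
exists (rot1 R), (rot2 R); split.
- by apply/symgroup4P; split; [exact: rot1_SO3|rewrite act4_rot1 oppr0].
- by apply/symgroup4P; split; [exact: rot2_SO3|rewrite act4_rot2 oppr0].
- by apply: (@entry_neq _ _ i1 i1); rewrite !mxE /=; apply/eqP; lra.
- by apply: (@entry_neq _ _ i0 i0); rewrite !mxE /=; apply/eqP; lra.
- by apply: (@entry_neq _ _ i1 i1); rewrite !mxE /=; apply/eqP; lra.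
Qed.

Lemma big_cyclic T g : symgroup4 T g ->
  g <> 1%:M -> g *m g <> 1%:M -> g *m g <> g -> big_group (symgroup4 T).
Proof.
move=> gT g1 gg1 ggg; exists g, (g *m g); split=> //; last by move/esym.
move/symgroup4P: gT => [g_SO gT]; apply/symgroup4P.
by split; [exact: SO3_mul|rewrite -act4M !gT].
Qed.

Lemma big_quarter h1 h3 a : big_group (symgroup4 (harm h1 h1 h3 a (- a) 0 0 0 0)).
Proof.
apply: (@big_cyclic _ (rotz 0 1)).
- apply/symgroup4P; split; first by apply: rotz_SO3; ring.
  exact: act4_rotz_quarter.
- by apply: (@entry_neq _ _ i0 i0); rewrite !mxE /=; apply/eqP; lra.
- by apply: (@entry_neq _ _ i0 i0); rewrite mxE sum3 !mxE /=; apply/eqP; lra.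
- by apply: (@entry_neq _ _ i0 i0); rewrite mxE sum3 !mxE /=; apply/eqP; lra.
Qed.

Lemma big_third h A D :
  big_group (symgroup4 (harm (- 4 * h) (- 4 * h) h 0 0 A (- A) D (- D))).
Proof.
pose s : R := Num.sqrt (3 / 4).
have s2 : s ^+ 2 = 3 / 4 by rewrite sqr_sqrtr //; lra.
clearbody s.
apply: (@big_cyclic _ (rotz (- 2^-1) s)).
- apply/symgroup4P; split; first by apply: rotz_SO3; rewrite s2; field.
  by apply: act4_rotz_third; rewrite s2; field.
- by apply: (@entry_neq _ _ i0 i0); rewrite !mxE /=; apply/eqP; lra.
- apply: (@entry_neq _ _ i0 i0); rewrite mxE sum3 !mxE /=; apply/eqP.
  by rewrite (mulNr s) -(expr2 s) s2; lra.
- apply: (@entry_neq _ _ i1 i0); rewrite mxE sum3 !mxE /=; apply/eqP => e.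
  have s0 : s = 0 by lra.
  by move: s2; rewrite s0 expr0n /=; lra.
Qed.

Lemma big_cyc h1 h2 h3 a b A B D E :
  big_group (symgroup4 (harm h2 h3 h1 E (- (D + E)) b (- (a + b)) B (- (A + B)))) ->
  big_group (symgroup4 (harm h1 h2 h3 a b A B D E)).
Proof. by rewrite -act4_cyc; apply: big_group_act4; apply: cyc_SO3. Qed.

Section D2.
Variables (h1 h2 h3 a b A B D E : R).
Let T := harm h1 h2 h3 a b A B D E.

Lemma d2_harm00 : d2 T i0 i0 = 4 * (h2 ^+ 2 + h3 ^+ 2) + 2 * h2 * h3 +
  4 * A ^+ 2 + 2 * A * B + 4 * B ^+ 2 + 6 * D ^+ 2 + 6 * a ^+ 2 + 6 * a * b + 4 * b ^+ 2.
Proof. by rewrite /d2 /tr13 mxE /dcontr44 !sum3 /T /harm /=; ring. Qed.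

Lemma d2_harm11 : d2 T i1 i1 = 4 * (h1 ^+ 2 + h3 ^+ 2) + 2 * h1 * h3 +
  6 * B ^+ 2 + 4 * D ^+ 2 + 2 * D * E + 4 * E ^+ 2 + 4 * a ^+ 2 + 6 * a * b + 6 * b ^+ 2.
Proof. by rewrite /d2 /tr13 mxE /dcontr44 !sum3 /T /harm /=; ring. Qed.

Lemma d2_harm22 : d2 T i2 i2 = 4 * (h1 ^+ 2 + h2 ^+ 2) + 2 * h1 * h2 +
  4 * A ^+ 2 + 6 * A * B + 6 * B ^+ 2 + 6 * D ^+ 2 + 6 * D * E + 4 * E ^+ 2 +
  6 * a ^+ 2 + 12 * a * b + 6 * b ^+ 2.
Proof. by rewrite /d2 /tr13 mxE /dcontr44 !sum3 /T /harm /=; ring. Qed.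

Lemma d2_harm01 : d2 T i0 i1 = 4 * A * D + A * E + 7 * B * D + 4 * B * E -
  a * (3 * h1 + 4 * h2 - 2 * h3) - b * (4 * h1 + 3 * h2 - 2 * h3).
Proof. by rewrite /d2 /tr13 mxE /dcontr44 !sum3 /T /harm /=; ring. Qed.

Lemma d2_harm02 : d2 T i0 i2 = A * (h1 - h3) + B * (4 * h1 - 2 * h2 + 3 * h3) -
  3 * D * b + 3 * E * a + 4 * E * b.
Proof. by rewrite /d2 /tr13 mxE /dcontr44 !sum3 /T /harm /=; ring. Qed.

Lemma d2_harm12 : d2 T i1 i2 = 4 * A * a + 3 * A * b - 3 * B * a +
  D * (4 * h2 - 2 * h1 + 3 * h3) + E * (h2 - h3).
Proof. by rewrite /d2 /tr13 mxE /dcontr44 !sum3 /T /harm /=; ring. Qed.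
End D2.

(** Only weights 0, 3 and 4 are present. With [u = A + i D] (weight 3) and [w = (h1 + 4 h3) + 4 i a]
    (weight 4), the hypotheses are the real and imaginary parts of [u w = 0]: a quarter turn fixes
    [H] if [u = 0], a third of a turn if [w = 0]. *)
Lemma big_planar h1 h3 a A D :
  A * (h1 + 4 * h3) = 4 * D * a -> D * (h1 + 4 * h3) = - (4 * A * a) ->
  big_group (symgroup4 (harm h1 h1 h3 a (- a) A (- A) D (- D))).
Proof.
move=> e02 e12.
have eL : (A ^+ 2 + D ^+ 2) * (h1 + 4 * h3) = 0.
  by rewrite mulrDl !expr2 -!mulrA e02 e12; ring.
have [/eqP|AD0] := eqVneq (A ^+ 2 + D ^+ 2) 0.
  rewrite paddr_eq0 ?sqr_ge0 // !sqrf_eq0 => /andP[/eqP-> /eqP->].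
  by rewrite oppr0; apply: big_quarter.
have L0 : h1 + 4 * h3 = 0 by move/eqP: eL; rewrite mulf_eq0 (negPf AD0) => /eqP.
have h1E : h1 = - 4 * h3 by lra.
have a0 : a = 0.
  apply/eqP; move: AD0; apply: contraNT => a0.
  have Aa : A * a = 0 by move: e12; rewrite h1E; lra.
  have Da : D * a = 0 by move: e02; rewrite h1E; lra.
  move/eqP: Aa; rewrite mulf_eq0 (negPf a0) orbF => /eqP ->.
  move/eqP: Da; rewrite mulf_eq0 (negPf a0) orbF => /eqP ->.
  by rewrite expr0n addr0.
by rewrite a0 oppr0 h1E; apply: big_third.
Qed.
End BigGroups.

(** * Diagonal [d2] with [c3] proportional to it modulo the identity *)

Section RankOne.
Variable R : realType.
Implicit Types (h s x y z k m : R).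

(* For [H] with [H_{23ii} = s1 n_i], [H_{13ii} = s2 n_i], [H_{12ii} = s3 n_i] and
   [n = (x, y, z)] of sum zero, these are the entries (2,3) and (1,1) of [d2 H];
   the other ones follow by cyclic permutation. *)
Definition offdiag h1 h2 h3 s1 s2 s3 x y z :=
  s1 * (h2 * (3 * x - z) + h3 * (3 * x - y) - 2 * h1 * x) + 4 * x ^+ 2 * s2 * s3.
Definition ondiag h1 h2 h3 s1 s2 s3 x y z :=
  4 * (h2 ^+ 2 + h3 ^+ 2) + 2 * h2 * h3 + s3 ^+ 2 * (3 * x ^+ 2 + y ^+ 2 + 3 * z ^+ 2)
  + s2 ^+ 2 * (3 * x ^+ 2 + z ^+ 2 + 3 * y ^+ 2) + 6 * s1 ^+ 2 * x ^+ 2.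

(** The linear condition on [(h1, h2, h3)] has a plane of solutions, spanned by [(1, 1, 1)] and
    [(4x^2 + yz, 4y^2 + zx, 4z^2 + xy)]. *)
Lemma even_part_param h1 h2 h3 x y z : x + y + z = 0 ->
  x != 0 -> y != 0 -> z != 0 ->
  h1 * x * (y - z) + h2 * y * (z - x) + h3 * z * (x - y) = 0 ->
  exists k m, [/\ h1 = m + k * (4 * x ^+ 2 + y * z),
    h2 = m + k * (4 * y ^+ 2 + z * x) & h3 = m + k * (4 * z ^+ 2 + x * y)].
Proof.
move=> s0 x0 y0 z0; set e := (X in X = 0 -> _) => e0.
have zE : z = - (x + y) by lra.
(* Pairing with [(x, y, z)] removes [m]; since [x^3 + y^3 + z^3 = 3xyz], the second generator pairs
   to [15xyz]. Summing the three equations then gives [m]. *)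
pose k := (x * h1 + y * h2 + z * h3) / (15 * x * y * z).
pose m := (h1 + h2 + h3 - k * (4 * (x ^+ 2 + y ^+ 2 + z ^+ 2) + y * z + z * x + x * y)) / 3.
have xy0 : x + y != 0 by rewrite -oppr_eq0 -zE.
exists k, m; split.
(* For arbitrary [h1] the two sides differ by this multiple of [e], which vanishes by hypothesis. *)
- transitivity (m + k * (4 * x ^+ 2 + y * z) - (y - z) * e / (9 * x * y * z)); last first.
    by rewrite e0; field; rewrite ?x0 ?y0 ?z0.
  by rewrite /m /k /e zE; field; rewrite ?x0 ?y0 ?xy0.
- transitivity (m + k * (4 * y ^+ 2 + z * x) - (z - x) * e / (9 * x * y * z)); last first.
    by rewrite e0; field; rewrite ?x0 ?y0 ?z0.
  by rewrite /m /k /e zE; field; rewrite ?x0 ?y0 ?xy0.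
- transitivity (m + k * (4 * z ^+ 2 + x * y) - (x - y) * e / (9 * x * y * z)); last first.
    by rewrite e0; field; rewrite ?x0 ?y0 ?z0.
  by rewrite /m /k /e zE; field; rewrite ?x0 ?y0 ?xy0.
Qed.

(** With this even part the whole entry is divisible by [x], and the quotient is the conclusion. *)
Lemma offdiag_param k m x y z s1 s2 s3 : x + y + z = 0 -> x != 0 ->
  offdiag (m + k * (4 * x ^+ 2 + y * z)) (m + k * (4 * y ^+ 2 + z * x))
    (m + k * (4 * z ^+ 2 + x * y)) s1 s2 s3 x y z = 0 ->
  s1 * (5 * m - 20 * y * z * k) + 4 * x * s2 * s3 = 0.
Proof.
move=> s0 x0 e; apply: (mulfI x0); rewrite mulr0 -[RHS]e /offdiag.
have -> : z = - (x + y) by lra.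
by ring.
Qed.

(** The case where only [s3] may be nonzero: the weighted sum fixes [s3^2], and that value makes the
    three diagonal entries of [d2] equal. *)
Lemma ondiag_eq_one k m x y z s3 : x + y + z = 0 ->
  x != 0 -> y != 0 -> z != 0 -> m = 4 * x * y * k ->
  let h1 := m + k * (4 * x ^+ 2 + y * z) in
  let h2 := m + k * (4 * y ^+ 2 + z * x) in
  let h3 := m + k * (4 * z ^+ 2 + x * y) in
  x * ondiag h1 h2 h3 0 0 s3 x y z + y * ondiag h2 h3 h1 0 s3 0 y z x +
    z * ondiag h3 h1 h2 s3 0 0 z x y = 0 ->
  ondiag h1 h2 h3 0 0 s3 x y z = ondiag h2 h3 h1 0 s3 0 y z x /\
  ondiag h2 h3 h1 0 s3 0 y z x = ondiag h3 h1 h2 s3 0 0 z x y.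
Proof.
move=> s0 x0 y0 z0 mE /= e.
have zE : z = - (x + y) by lra.
(* After substitution the weighted sum is [8xyz] times the difference of these two sides. *)
have s3E : s3 ^+ 2 = 25 * k ^+ 2 * (2 * x + y) * (x + 2 * y).
  have c0 : 8 * x * y * z != 0 by rewrite !mulf_neq0 // pnatr_eq0.
  apply: (mulfI c0); apply/eqP; rewrite -subr_eq0; apply/eqP.
  by rewrite -[RHS]e /ondiag mE zE; ring.
by split; rewrite /ondiag mE zE; ring: s3E.
Qed.

Lemma ondiag_eq_all k m x y z s1 s2 s3 : x + y + z = 0 ->
  x != 0 -> y != 0 -> z != 0 ->
  x * y * s3 ^+ 2 = 25 / 16 * (4 * y * z * k - m) * (4 * z * x * k - m) ->
  y * z * s1 ^+ 2 = 25 / 16 * (4 * z * x * k - m) * (4 * x * y * k - m) ->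
  z * x * s2 ^+ 2 = 25 / 16 * (4 * x * y * k - m) * (4 * y * z * k - m) ->
  let h1 := m + k * (4 * x ^+ 2 + y * z) in
  let h2 := m + k * (4 * y ^+ 2 + z * x) in
  let h3 := m + k * (4 * z ^+ 2 + x * y) in
  ondiag h1 h2 h3 s1 s2 s3 x y z = ondiag h2 h3 h1 s2 s3 s1 y z x.
Proof.
move=> s0 x0 y0 z0 e3 e1 e2 /=.
have zE : z = - (x + y) by lra.
have c0 : x * y * z != 0 by rewrite !mulf_neq0.
apply: (mulfI c0); apply/eqP; rewrite -subr_eq0; apply/eqP.
rewrite /ondiag; set h1 := m + k * (4 * x ^+ 2 + y * z).
set h2 := m + k * (4 * y ^+ 2 + z * x); set h3 := m + k * (4 * z ^+ 2 + x * y).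
(* Grouped so that each [s_i^2] occurs only inside the product whose value is given. *)
transitivity (x * y * z * (4 * h2 ^+ 2 + 2 * h2 * h3 - 4 * h1 ^+ 2 - 2 * h1 * h3) +
  2 * z * (x ^+ 2 - y ^+ 2) * (x * y * s3 ^+ 2) +
  y * (3 * x ^+ 2 + z ^+ 2 - 3 * y ^+ 2) * (z * x * s2 ^+ 2) +
  x * (3 * x ^+ 2 - z ^+ 2 - 3 * y ^+ 2) * (y * z * s1 ^+ 2)); first by ring.
by rewrite e1 e2 e3 /h1 /h2 /h3 zE; field.
Qed.

(** Here [n = (x, -x, 0)], so weights 1 and 2 about the third axis vanish, and the two entries of
    [d2] become the equations of [big_planar]. *)
Lemma big_rank_one_n3 h1 h2 h3 s1 s2 s3 x y : x != 0 -> x + y = 0 ->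
  h1 * x * y = h2 * y * x ->
  offdiag h1 h2 h3 s1 s2 s3 x y 0 = 0 -> offdiag h2 h3 h1 s2 s3 s1 y 0 x = 0 ->
  big_group (symgroup4 (harm h1 h2 h3 (s3 * x) (s3 * y) (s2 * x) (s2 * y) (s1 * x) (s1 * y))).
Proof.
move=> x0 s0; have -> : y = - x by lra.
rewrite /offdiag => e0 e1 e2.
have h12 : h1 = h2 by apply: (mulIf x0); apply: (mulIf x0); move: e0; lra.
subst h2.
rewrite !mulrN; apply: big_planar.
  by apply/eqP; rewrite -subr_eq0 -oppr_eq0; apply/eqP; rewrite -[RHS]e2; ring.
by apply/eqP; rewrite -subr_eq0; apply/eqP; rewrite -[RHS]e1; ring.
Qed.

(** By the number of nonzero [s_i]: exactly two contradict the off-diagonal equation of the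
    vanishing one; one or three force equal diagonal entries in [d2], which is excluded. *)
Lemma big_rank_one_n_neq0 h1 h2 h3 s1 s2 s3 x y z : x + y + z = 0 ->
  x != 0 -> y != 0 -> z != 0 ->
  h1 * x * (y - z) + h2 * y * (z - x) + h3 * z * (x - y) = 0 ->
  offdiag h1 h2 h3 s1 s2 s3 x y z = 0 -> offdiag h2 h3 h1 s2 s3 s1 y z x = 0 ->
  offdiag h3 h1 h2 s3 s1 s2 z x y = 0 ->
  x * ondiag h1 h2 h3 s1 s2 s3 x y z + y * ondiag h2 h3 h1 s2 s3 s1 y z x +
    z * ondiag h3 h1 h2 s3 s1 s2 z x y = 0 ->
  ~ (ondiag h1 h2 h3 s1 s2 s3 x y z = ondiag h2 h3 h1 s2 s3 s1 y z x /\
     ondiag h2 h3 h1 s2 s3 s1 y z x = ondiag h3 h1 h2 s3 s1 s2 z x y) ->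
  [/\ s1 = 0, s2 = 0 & s3 = 0].
Proof.
move=> s0 x0 y0 z0 e0.
have [k [m [-> -> ->]]] := even_part_param s0 x0 y0 z0 e0.
have s0' : y + z + x = 0 by lra.
have s0'' : z + x + y = 0 by lra.
move=> /(offdiag_param s0 x0) e1 /(offdiag_param s0' y0) e2.
move=> /(offdiag_param s0'' z0) e3.
set t1 := _ - _ in e1; set t2 := _ - _ in e2; set t3 := _ - _ in e3.
have neqz u v : u != 0 :> R -> u * v = 0 -> v = 0.
  by move=> u0 /eqP; rewrite mulf_eq0 (negPf u0) => /eqP.
have [s1_0|s1_0] := eqVneq s1 0; have [s2_0|s2_0] := eqVneq s2 0;
  have [s3_0|s3_0] := eqVneq s3 0 => ed nd.
- by [].
- case: nd; subst s1 s2; apply: ondiag_eq_one => //.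
  have : t3 = 0 by apply: (neqz _ _ s3_0); rewrite -[RHS]e3; ring.
  by rewrite /t3; lra.
- case: nd; subst s1 s3.
  have t0 : t2 = 0 by apply: (neqz _ _ s2_0); rewrite -[RHS]e2; ring.
  have mE : m = 4 * z * x * k by move: t0; rewrite /t2; lra.
  have [|d31 d12] := ondiag_eq_one s0'' z0 x0 y0 mE (s3 := s2).
    by rewrite -addrA addrC.
  by split=> //; rewrite d31 d12.
- exfalso; move/eqP: e1; rewrite s1_0 mul0r add0r.
  by rewrite !mulf_eq0 (negPf x0) (negPf s2_0) (negPf s3_0) pnatr_eq0.
- case: nd; subst s2 s3.
  have t0 : t1 = 0 by apply: (neqz _ _ s1_0); rewrite -[RHS]e1; ring.
  have mE : m = 4 * y * z * k by move: t0; rewrite /t1; lra.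
  have [|d23 d31] := ondiag_eq_one s0' y0 z0 x0 mE (s3 := s1).
    by rewrite addrC addrA.
  by split; rewrite // d23 d31.
- exfalso; move/eqP: e2; rewrite s2_0 mul0r add0r.
  by rewrite !mulf_eq0 (negPf y0) (negPf s1_0) (negPf s3_0) pnatr_eq0.
- exfalso; move/eqP: e3; rewrite s3_0 mul0r add0r.
  by rewrite !mulf_eq0 (negPf z0) (negPf s1_0) (negPf s2_0) pnatr_eq0.
exfalso; apply: nd.
(* Multiplying two off-diagonal equations cancels [u v] and isolates the square of the third
   unknown. *)
have prod (u v w p q a b : R) : u != 0 -> v != 0 -> u * p + 4 * a * v * w = 0 ->
    v * q + 4 * b * w * u = 0 -> a * b * w ^+ 2 = 1 / 16 * p * q.
  move=> u0 v0 ep eq; have uv0 : 16 * u * v != 0 by rewrite !mulf_neq0 // pnatr_eq0.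
  apply: (mulfI uv0); transitivity ((4 * a * v * w) * (4 * b * w * u)); first by ring.
  have -> : 4 * a * v * w = - (u * p) by lra.
  have -> : 4 * b * w * u = - (v * q) by lra.
  by field.
have q3 := prod _ _ _ _ _ _ _ s1_0 s2_0 e1 e2.
have q1 := prod _ _ _ _ _ _ _ s2_0 s3_0 e2 e3.
have q2 := prod _ _ _ _ _ _ _ s3_0 s1_0 e3 e1.
by split; apply: ondiag_eq_all => //; rewrite ?q1 ?q2 ?q3 /t1 /t2 /t3; field.
Qed.

(** In the application [n] is the cross product of the diagonal of [d2] with [(1, 1, 1)]. The
    hypotheses then say that [c3] is proportional to [d2] modulo the identity, that [d2] is
    diagonal, that its diagonal is orthogonal to [n], and that it is not scalar. *)
Lemma big_rank_one h1 h2 h3 s1 s2 s3 x y z : x + y + z = 0 ->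
  ~~ [&& x == 0, y == 0 & z == 0] ->
  h1 * x * (y - z) + h2 * y * (z - x) + h3 * z * (x - y) = 0 ->
  offdiag h1 h2 h3 s1 s2 s3 x y z = 0 -> offdiag h2 h3 h1 s2 s3 s1 y z x = 0 ->
  offdiag h3 h1 h2 s3 s1 s2 z x y = 0 ->
  x * ondiag h1 h2 h3 s1 s2 s3 x y z + y * ondiag h2 h3 h1 s2 s3 s1 y z x +
    z * ondiag h3 h1 h2 s3 s1 s2 z x y = 0 ->
  ~ (ondiag h1 h2 h3 s1 s2 s3 x y z = ondiag h2 h3 h1 s2 s3 s1 y z x /\
     ondiag h2 h3 h1 s2 s3 s1 y z x = ondiag h3 h1 h2 s3 s1 s2 z x y) ->
  big_group (symgroup4 (harm h1 h2 h3 (s3 * x) (s3 * y) (s2 * x) (s2 * y) (s1 * x) (s1 * y))).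
Proof.
move=> s0 n0 e0 e1 e2 e3 ed nd.
have zE : z = - (x + y) by lra.
(* These identities restore the rank-one shape after the axes are permuted to put a zero coordinate
   of [n] last. *)
have opp (u : R) : - (u * x + u * y) = u * z by rewrite zE; ring.
have opp' (u : R) : - (u * y + u * z) = u * x by rewrite zE; ring.
have cyc_n0 (u v w : R) : ~~ [&& u == 0, v == 0 & w == 0] -> u + v + w = 0 -> w = 0 -> u != 0.
  move=> n0' uvw w0; apply: contraNneq n0' => u0; rewrite u0 w0 !eqxx andbT /=.
  by apply/eqP; lra.
have [z0|z0] := eqVneq z 0.
  have x0 := cyc_n0 _ _ _ n0 s0 z0; rewrite z0 in e0 e1 e2 e3 s0.
  by apply: big_rank_one_n3 => //; lra.
have n0' : ~~ [&& y == 0, z == 0 & x == 0] by rewrite andbA andbC.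
have n0'' : ~~ [&& z == 0, x == 0 & y == 0] by rewrite andbC -andbA.
have [x0|x0] := eqVneq x 0.
  apply: big_cyc; rewrite !opp.
  have s0' : y + z + x = 0 by lra.
  have y0 := cyc_n0 _ _ _ n0' s0' x0; rewrite x0 in e0 e1 e2 e3 s0.
  by apply: big_rank_one_n3 => //; lra.
have [y0|y0] := eqVneq y 0.
  apply: big_cyc; rewrite !opp; apply: big_cyc; rewrite !opp'.
  rewrite y0 in e0 e1 e2 e3 s0.
  by apply: big_rank_one_n3 => //; lra.
have [-> -> ->] := big_rank_one_n_neq0 s0 x0 y0 z0 e0 e1 e2 e3 ed nd.
by rewrite !mul0r; apply: big_diag.
Qed.
End RankOne.

(** * A critical frame *)

Section Extremal.
Variable R : realType.
Implicit Types (g : 'M[R]_3) (T : tensor4 R) (c s t p q r : R).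

Lemma rotz_annihilate p q : exists c s, c ^+ 2 + s ^+ 2 = 1 /\ s * p + c * q = 0.
Proof.
have [pq0|pq0] := eqVneq (p ^+ 2 + q ^+ 2) 0.
  move/eqP: pq0; rewrite paddr_eq0 ?sqr_ge0 // !sqrf_eq0 => /andP[/eqP-> /eqP->].
  by exists 1, 0; split; ring.
have pq_gt0 : 0 < p ^+ 2 + q ^+ 2 by rewrite lt_def pq0 addr_ge0 ?sqr_ge0.
pose rho := Num.sqrt (p ^+ 2 + q ^+ 2).
have rho2 : rho ^+ 2 = p ^+ 2 + q ^+ 2 by rewrite sqr_sqrtr ?ltW.
have rho0 : rho != 0 by rewrite gt_eqF ?sqrtr_gt0.
exists (p / rho), (- q / rho); split; last by field.
by rewrite !expr_div_n rho2; field.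
Qed.

(** The left side is the off-diagonal entry of a rotated symmetric planar block with diagonal
    difference [p] and off-diagonal entry [q]. In [t = s / c] it reads [q t^2 = p t + q], whose
    discriminant is nonnegative. *)
Lemma rotz_diagonalize p q : exists c s,
  c ^+ 2 + s ^+ 2 = 1 /\ c * s * p + (c ^+ 2 - s ^+ 2) * q = 0.
Proof.
have [->|q0] := eqVneq q 0; first by exists 1, 0; split; ring.
pose r := Num.sqrt (p ^+ 2 + 4 * q ^+ 2).
have r2 : r ^+ 2 = p ^+ 2 + 4 * q ^+ 2.
  by rewrite sqr_sqrtr //; have := sqr_ge0 p; have := sqr_ge0 q; lra.
pose t := (p + r) / (2 * q).
have tE : q * t ^+ 2 = p * t + q.
  by rewrite /t expr_div_n sqrrD r2; field.
have t_gt0 : 0 < 1 + t ^+ 2 by rewrite ltr_pwDl ?sqr_ge0.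
pose c := (Num.sqrt (1 + t ^+ 2))^-1.
have c2 : c ^+ 2 * (1 + t ^+ 2) = 1.
  by rewrite exprVn sqr_sqrtr ?ltW // mulVf // gt_eqF.
exists c, (t * c); split; first by rewrite -c2; ring.
transitivity (c ^+ 2 * (p * t + q - q * t ^+ 2)); first by ring.
by rewrite tE subrr mulr0.
Qed.

(** A first-derivative test at the maximum [(c, s) = (1, 0)], carried out by inequalities instead of
    differentiation. *)
Lemma quartic_critical (M r0 r1 r2 r3 : R) :
  (forall c s, c ^+ 2 + s ^+ 2 = 1 -> c ^+ 4 * M + 4 * c ^+ 3 * s * r3 +
     6 * c ^+ 2 * s ^+ 2 * r2 + 4 * c * s ^+ 3 * r1 + s ^+ 4 * r0 <= M) ->
  r3 = 0.
Proof.
move=> leM.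
(* The bound on the circle divided by [c^4], with [t = s / c]. *)
have leMt t : M + 4 * t * r3 + 6 * t ^+ 2 * r2 + 4 * t ^+ 3 * r1 + t ^+ 4 * r0
    <= M * (1 + t ^+ 2) ^+ 2.
  have t_gt0 : 0 < 1 + t ^+ 2 by rewrite ltr_pwDl ?sqr_ge0.
  pose c := (Num.sqrt (1 + t ^+ 2))^-1.
  have c2 : c ^+ 2 * (1 + t ^+ 2) = 1.
    by rewrite exprVn sqr_sqrtr ?ltW // mulVf // gt_eqF.
  have c_gt0 : 0 < c by rewrite invr_gt0 sqrtr_gt0.
  have c4_gt0 : 0 < c ^+ 4 by rewrite exprn_gt0.
  rewrite -(ler_pM2l c4_gt0).
  have -> : c ^+ 4 * (M * (1 + t ^+ 2) ^+ 2) = (c ^+ 2 * (1 + t ^+ 2)) ^+ 2 * M by ring.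
  rewrite c2 expr1n mul1r; apply: le_trans (leM c (t * c) _).
    by rewrite le_eqVlt; apply/orP; left; apply/eqP; ring.
  by rewrite -c2; ring.
apply/eqP; apply: contraT => r3_0.
(* For [|t| <= 1] the terms beyond first order are at most [K t^2]. With [t = r3 / N] the linear
   term is [4 N t^2], which is too large since [N > K]. *)
pose K := `|2 * M - 6 * r2| + `|4 * r1| + `|M - r0|.
have K_ge0 : 0 <= K by rewrite !addr_ge0.
pose N := `|r3| + K + 1.
have N_gt0 : 0 < N by rewrite ltr_wpDl // addr_ge0.
have N0 : N != 0 by rewrite gt_eqF.
pose t := r3 / N.
have t_le1 : `|t| <= 1.
  by rewrite normrM normfV (gtr0_norm N_gt0) ler_pdivrMr // mul1r /N -addrA lerDl addr_ge0.
have t2_gt0 : 0 < t ^+ 2 by rewrite exprn_even_gt0 //= mulf_neq0 ?invr_eq0.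
have e : 4 * t * r3 = t ^+ 2 * (4 * N) by rewrite /t expr_div_n; field.
have : t ^+ 2 * (4 * N) <= t ^+ 2 * ((2 * M - 6 * r2) - 4 * r1 * t + (M - r0) * t ^+ 2).
  by rewrite -e; have := leMt t; lra.
rewrite ler_pM2l // => leN.
have b1 : - (4 * r1 * t) <= `|4 * r1|.
  by rewrite (le_trans (ler_norm _)) // normrN normrM ler_piMr.
have b2 : (M - r0) * t ^+ 2 <= `|M - r0|.
  rewrite (le_trans (ler_norm _)) // normrM ler_piMr // normrX.
  by rewrite exprn_ile1.
have b3 := ler_norm (2 * M - 6 * r2).
have leK : 4 * N <= K by rewrite (le_trans leN) // lerD // lerD.
by move: leK; rewrite {1}/N; have := normr_ge0 r3; clearbody K; lra.
Qed.

Definition rotx c s := mx3 1 0 0 0 c (- s) 0 s c.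
Definition roty c s := mx3 c 0 (- s) 0 1 0 s 0 c.

Lemma rotx_SO3 c s : c ^+ 2 + s ^+ 2 = 1 -> SO3 (rotx c s).
Proof.
move=> cs1; have c2 : c ^+ 2 = 1 - s ^+ 2 by rewrite -cs1; ring.
split; last by rewrite det3 !mxE /=; ring: c2.
by apply: matrix3P; rewrite mxE sum3 !mxE /=; ring: c2.
Qed.

Lemma roty_SO3 c s : c ^+ 2 + s ^+ 2 = 1 -> SO3 (roty c s).
Proof.
move=> cs1; have c2 : c ^+ 2 = 1 - s ^+ 2 by rewrite -cs1; ring.
split; last by rewrite det3 !mxE /=; ring: c2.
by apply: matrix3P; rewrite mxE sum3 !mxE /=; ring: c2.
Qed.

(** A turn about [e3] brings [v] into the plane of [e1] and [e3], and a turn about [e2] then aligns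
    it with [e3]. *)
Lemma SO3_last_row (v : 'rV[R]_3) :
  v ord0 i0 ^+ 2 + v ord0 i1 ^+ 2 + v ord0 i2 ^+ 2 = 1 ->
  exists g, SO3 g /\ row i2 g = v.
Proof.
move=> v1; have [c [s [cs1 e]]] := rotz_annihilate (v ord0 i0) (v ord0 i1).
pose w := c * v ord0 i0 - s * v ord0 i1.
have cw : c * w = v ord0 i0.
  transitivity ((c ^+ 2 + s ^+ 2) * v ord0 i0 - s * (s * v ord0 i0 + c * v ord0 i1)).
    by rewrite /w; ring.
  by rewrite cs1 e; ring.
have sw : - s * w = v ord0 i1.
  transitivity ((c ^+ 2 + s ^+ 2) * v ord0 i1 - c * (s * v ord0 i0 + c * v ord0 i1)).
    by rewrite /w; ring.
  by rewrite cs1 e; ring.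
have w2 : v ord0 i2 ^+ 2 + w ^+ 2 = 1.
  rewrite -v1 -cw -sw; transitivity (v ord0 i2 ^+ 2 + (c ^+ 2 + s ^+ 2) * w ^+ 2).
    by rewrite cs1 mul1r.
  by ring.
exists (roty (v ord0 i2) w *m rotz c s); split.
  by apply: SO3_mul; [apply: roty_SO3|apply: rotz_SO3].
apply/rowP; elim/ord3_ind; rewrite !mxE sum3 !mxE /=.
- by rewrite -[RHS]cw; ring.
- by rewrite -[RHS]sw; ring.
- by ring.
Qed.

Definition quartic T (v : 'rV[R]_3) : R :=
  \sum_(a < 3) \sum_(b < 3) \sum_(c < 3) \sum_(d < 3)
    v ord0 a * v ord0 b * v ord0 c * v ord0 d * T a b c d.

Lemma quartic_row T g : quartic T (row i2 g) = act4 g T i2 i2 i2 i2.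
Proof. by do 4!apply: eq_bigr => ? _; rewrite !mxE. Qed.

Lemma continuous_sum3 (F : 'I_3 -> 'rV[R]_3 -> R) :
  (forall i, continuous (F i)) -> continuous (fun v => \sum_(i < 3) F i v).
Proof.
move=> cF; rewrite (_ : (fun v => _) = F i0 \+ F i1 \+ F i2); last first.
  by apply/funext => v; rewrite sum3.
by move=> v; apply: continuousD; [apply: continuousD|]; apply: cF.
Qed.

Lemma quartic_continuous T : continuous (quartic T).
Proof.
have cM (f g : 'rV[R]_3 -> R) :
    continuous f -> continuous g -> continuous (fun v => f v * g v).
  by move=> cf cg v; apply: continuousM; [apply: cf|apply: cg].
apply: continuous_sum3 => a; apply: continuous_sum3 => b.
apply: continuous_sum3 => c; apply: continuous_sum3 => d.
apply: (cM (fun v => v ord0 a * v ord0 b * v ord0 c * v ord0 d)); last exact: cst_continuous.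
apply: (cM (fun v => v ord0 a * v ord0 b * v ord0 c)); last exact: coord_continuous.
apply: (cM (fun v => v ord0 a * v ord0 b)); last exact: coord_continuous.
by apply: cM; apply: coord_continuous.
Qed.

Lemma quartic_max T : exists2 v : 'rV[R]_3,
  v ord0 i0 ^+ 2 + v ord0 i1 ^+ 2 + v ord0 i2 ^+ 2 = 1 &
  forall w : 'rV[R]_3, w ord0 i0 ^+ 2 + w ord0 i1 ^+ 2 + w ord0 i2 ^+ 2 = 1 ->
    quartic T w <= quartic T v.
Proof.
pose n2 (v : 'rV[R]_3) : R := \sum_(i < 3) v ord0 i * v ord0 i.
have n2E v : n2 v = v ord0 i0 ^+ 2 + v ord0 i1 ^+ 2 + v ord0 i2 ^+ 2.
  by rewrite /n2 sum3 !expr2.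
pose S := [set v : 'rV[R]_3 | n2 v = 1]%classic.
have S_closed : closed S.
  apply: (@preimage_closed _ _ n2 [set x | x = 1]%classic); last exact: closed_eq.
  move=> v _; apply: continuous_sum3 => i {}v.
  by apply: continuousM; apply: coord_continuous.
have S_compact : compact S.
  (* The sphere is compact as a closed subset of the cube. *)
  have box_compact : compact [set v : 'rV[R]_3 | forall i, `[(-1 : R), 1]%classic (v ord0 i)]%classic.
    by apply: (@rV_compact _ _ (fun=> `[(-1 : R), 1]%classic)) => _; apply: segment_compact.
  apply: subclosed_compact S_closed box_compact _ => v /= Sv i.
  rewrite in_itv /= -ler_norml -(@ler_pXn2r _ 2) ?nnegrE // expr1n real_normK ?num_real //.
  rewrite -Sv /n2 (bigD1 i) //= expr2 lerDl sumr_ge0 // => j _.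
  by rewrite -expr2 sqr_ge0.
have [||v /set_mem Sv vmax] := EVT_max_rV (f := quartic T) _ S_compact.
- exists (delta_mx ord0 i0); rewrite /S /= n2E !mxE /=; ring.
- by apply: continuous_subspaceT; apply: quartic_continuous.
by exists v => [|w w1]; [rewrite -n2E|apply: vmax; apply/mem_set; rewrite /S /= n2E].
Qed.

(** Take [e3] to maximise [H(v, v, v, v)] on the sphere: [H_1333] and [H_2333] are, up to the factor
    4, its derivatives at [e3] along two great circles. *)
Lemma exists_critical_frame T : in_H4 T -> exists g,
  [/\ SO3 g, act4 g T i0 i2 i2 i2 = 0 & act4 g T i1 i2 i2 i2 = 0].
Proof.
move=> T_H4; have [v v1 vmax] := quartic_max T.
have [g [g_SO gv]] := SO3_last_row v1.
set U := act4 g T.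
have U_H4 : in_H4 U by apply: act4_in_H4.
have Umax k : SO3 k -> act4 k U i2 i2 i2 i2 <= U i2 i2 i2 i2.
  move=> k_SO; rewrite /U act4M -!quartic_row gv; apply: vmax.
  have [kg1 _] := SO3_mul k_SO g_SO.
  by move/matrixP: kg1 => /(_ i2 i2); rewrite !mxE sum3 !mxE !expr2.
exists g; rewrite -/U; clearbody U; split=> //.
- apply: (quartic_critical (M := U i2 i2 i2 i2) (r0 := U i0 i0 i0 i0)
    (r1 := U i0 i0 i0 i2) (r2 := U i0 i0 i2 i2)) => c s cs1.
  apply: le_trans (Umax _ (roty_SO3 cs1)); rewrite le_eqVlt; apply/orP; left.
  apply/eqP; rewrite act4E.
  have ry f : app (roty c s) f i2 = s * f i0 + c * f i2.
    by have [_ _ ->] := app_mx3 c 0 (- s) 0 1 0 s 0 c f; ring.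
  by rewrite !ry (harmE U_H4) /harm /=; ring.
- apply: (quartic_critical (M := U i2 i2 i2 i2) (r0 := U i1 i1 i1 i1)
    (r1 := U i1 i1 i1 i2) (r2 := U i1 i1 i2 i2)) => c s cs1.
  apply: le_trans (Umax _ (rotx_SO3 cs1)); rewrite le_eqVlt; apply/orP; left.
  apply/eqP; rewrite act4E.
  have rx f : app (rotx c s) f i2 = s * f i1 + c * f i2.
    by have [_ _ ->] := app_mx3 1 0 0 0 c (- s) 0 s c f; ring.
  by rewrite !rx (harmE U_H4) /harm /=; ring.
Qed.
End Extremal.

(** * Commuting covariants *)

Section DiagonalCase.
Variable R : realType.
Implicit Types (g : 'M[R]_3) (T : tensor4 R) (h a b A B D E l : R).

Lemma d2_act4_scalar g T l : SO3 g -> in_H4 T -> d2 T = l%:M -> d2 (act4 g T) = l%:M.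
Proof.
move=> g_SO T_H4 dT; rewrite d2_equiv // dT /act2 scalar_mxC -mulmxA.
by case: g_SO => -> _; rewrite mulmx1.
Qed.

(** A turn about [e3] reaches [H_1233 = 0], that is [b = -a]. Then [d2_12 = 0] reads
    [a (h1 - h2) = 0], which leaves a diagonal tensor or one with a quarter turn. *)
Lemma big_scalar_monoclinic h1 h2 h3 a b l :
  d2 (harm h1 h2 h3 a b 0 0 0 0) = l%:M ->
  big_group (symgroup4 (harm h1 h2 h3 a b 0 0 0 0)).
Proof.
set T := harm _ _ _ _ _ _ _ _ _ => dT.
have [c [s [cs1 e]]] := rotz_diagonalize (h2 - h1) (- (a + b)).
have k_SO := rotz_SO3 cs1; have T_H4 : in_H4 T by apply: harm_in_H4.
apply: (big_group_act4 k_SO).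
have := harmE (act4_in_H4 k_SO T_H4); have := d2_act4_scalar k_SO T_H4 dT.
have U0122 : act4 (rotz c s) T i0 i1 i2 i2 = 0.
  by rewrite act4E !app_rotz /T /harm /= -[RHS]e; ring.
have U0002 : act4 (rotz c s) T i0 i0 i0 i2 = 0.
  by rewrite act4E !app_rotz /T /harm /=; ring.
have U0112 : act4 (rotz c s) T i0 i1 i1 i2 = 0.
  by rewrite act4E !app_rotz /T /harm /=; ring.
have U0012 : act4 (rotz c s) T i0 i0 i1 i2 = 0.
  by rewrite act4E !app_rotz /T /harm /=; ring.
have U1112 : act4 (rotz c s) T i1 i1 i1 i2 = 0.
  by rewrite act4E !app_rotz /T /harm /=; ring.
rewrite U0002 U0112 U0012 U1112; move: U0122.
move: (act4 _ T) => U U0122 + UE; move: U0122; rewrite UE.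
move: (U i1 i1 i2 i2) (U i0 i0 i2 i2) (U i0 i0 i1 i1) (U i0 i0 i0 i1) (U i0 i1 i1 i1).
move=> {UE U} h1' h2' h3' a' b'; rewrite {1}/harm /= => ab'.
have -> : b' = - a' by lra.
move/matrixP/(_ i0 i1); rewrite d2_harm01 mxE /= mulr0n => d01.
have /eqP : a' * (h1' - h2') = 0 by rewrite -[RHS]d01; ring.
rewrite mulf_eq0 subr_eq0 => /orP[/eqP->|/eqP->].
  by rewrite oppr0; apply: big_diag.
exact: big_quarter.
Qed.

(** In a critical frame, a turn about [e3] also kills [H_1233] and keeps [H_1333 = H_2333 = 0]. Then
    [d2_12 = 0] gives [h1 = h2], where [big_planar] applies, or [a = 0], where [A] or [D] vanishes
    and a coordinate half-turn fixes [H]. *)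
Lemma big_scalar T l : in_H4 T -> d2 T = l%:M -> big_group (symgroup4 T).
Proof.
move=> T_H4 dT; have [g [g_SO U0222 U1222]] := exists_critical_frame T_H4.
apply: (big_group_act4 g_SO).
have := d2_act4_scalar g_SO T_H4 dT; have := act4_in_H4 g_SO T_H4.
move: U0222 U1222; move: (act4 g T) => U U0222 U1222 U_H4 dU.
have [c [s [cs1 e]]] := rotz_diagonalize (U i0 i0 i2 i2 - U i1 i1 i2 i2) (U i0 i1 i2 i2).
have k_SO := rotz_SO3 cs1.
apply: (big_group_act4 k_SO).
have W0122 : act4 (rotz c s) U i0 i1 i2 i2 = 0.
  rewrite act4E !app_rotz -[RHS]e.
  have -> : U i1 i0 i2 i2 = U i0 i1 i2 i2 by case: U_H4 => /(_ i0 i1 i2 i2)[].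
  by ring.
have W0222 : act4 (rotz c s) U i0 i2 i2 i2 = 0.
  by rewrite act4E !app_rotz U0222 U1222; ring.
have W1222 : act4 (rotz c s) U i1 i2 i2 i2 = 0.
  by rewrite act4E !app_rotz U0222 U1222; ring.
have := d2_act4_scalar k_SO U_H4 dU; have := harmE (act4_in_H4 k_SO U_H4).
move: W0122 W0222 W1222; move: (act4 _ U) => W W0122 W0222 W1222 WE.
move: W0122 W0222 W1222; rewrite WE /=.
move: (W i1 i1 i2 i2) (W i0 i0 i2 i2) (W i0 i0 i1 i1) (W i0 i0 i0 i1)
  (W i0 i1 i1 i1) (W i0 i0 i0 i2) (W i0 i1 i1 i2) (W i0 i0 i1 i2) (W i1 i1 i1 i2).
move=> {WE W} h1 h2 h3 a b A B D E; rewrite /harm /= => ab AB DE.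
rewrite -/(harm h1 h2 h3 a b A B D E).
have -> : b = - a by lra.
have -> : B = - A by lra.
have -> : E = - D by lra.
move=> dW; have := dW => /matrixP/(_ i0 i1); have := dW => /matrixP/(_ i0 i2).
have := dW => /matrixP/(_ i1 i2).
rewrite d2_harm01 d2_harm02 d2_harm12 !mxE /= !mulr0n => d12 d02 d01.
have [h12|h12] := eqVneq h1 h2.
  rewrite h12 in d01 d02 d12 *; apply: big_planar.
    by apply/eqP; rewrite -subr_eq0 -oppr_eq0; apply/eqP; rewrite -[RHS]d02; ring.
  by apply/eqP; rewrite -subr_eq0; apply/eqP; rewrite -[RHS]d12; ring.
have a0 : a = 0.
  have /eqP : a * (h1 - h2) = 0 by rewrite -[RHS]d01; ring.
  by rewrite mulf_eq0 subr_eq0 (negPf h12) orbF => /eqP.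
rewrite a0 oppr0 in d02 d12 dW *.
have /eqP : A * (2 * h2 - 3 * h1 - 4 * h3) = 0 by rewrite -[RHS]d02; ring.
have /eqP : D * (3 * h2 - 2 * h1 + 4 * h3) = 0 by rewrite -[RHS]d12; ring.
rewrite !mulf_eq0 => /orP[/eqP D0|/eqP L1] /orP[/eqP A0|/eqP L2].
- by rewrite A0 D0 oppr0; apply: big_diag.
- rewrite D0 oppr0 in dW *; apply: big_cyc; apply: big_cyc.
  have := d2_act4_scalar (cyc_SO3 R) (act4_in_H4 (cyc_SO3 R) (harm_in_H4 _ _ _ _ _ _ _ _ _))
    (d2_act4_scalar (cyc_SO3 R) (harm_in_H4 _ _ _ _ _ _ _ _ _) dW).
  rewrite !act4_cyc !(addr0, add0r, oppr0, opprK, subrr).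
  exact: big_scalar_monoclinic.
- rewrite A0 oppr0 in dW *; apply: big_cyc.
  have := d2_act4_scalar (cyc_SO3 R) (harm_in_H4 _ _ _ _ _ _ _ _ _) dW.
  rewrite !act4_cyc !(addr0, add0r, oppr0, opprK, subrr).
  exact: big_scalar_monoclinic.
(* The two linear factors add up to [5 (h2 - h1)]. *)
- by case/negP: h12; apply/eqP; lra.
Qed.

Lemma dcontr42_harm_diag h1 h2 h3 a b A B D E (M : 'M[R]_3) :
  let T := harm h1 h2 h3 a b A B D E in
  (forall i j, i != j -> M i j = 0) ->
  [/\ dcontr42 T M i0 i0 = h3 * (M i1 i1 - M i0 i0) + h2 * (M i2 i2 - M i0 i0),
      dcontr42 T M i1 i1 = h3 * (M i0 i0 - M i1 i1) + h1 * (M i2 i2 - M i1 i1)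
    & dcontr42 T M i2 i2 = h2 * (M i0 i0 - M i2 i2) + h1 * (M i1 i1 - M i2 i2)] /\
  [/\ dcontr42 T M i0 i1 = a * (M i0 i0 - M i2 i2) + b * (M i1 i1 - M i2 i2),
      dcontr42 T M i0 i2 = A * (M i0 i0 - M i2 i2) + B * (M i1 i1 - M i2 i2)
    & dcontr42 T M i1 i2 = D * (M i0 i0 - M i2 i2) + E * (M i1 i1 - M i2 i2)].
Proof.
move=> T Mdiag.
have M01 := Mdiag i0 i1 isT; have M02 := Mdiag i0 i2 isT; have M12 := Mdiag i1 i2 isT.
have M10 := Mdiag i1 i0 isT; have M20 := Mdiag i2 i0 isT; have M21 := Mdiag i2 i1 isT.
by split; split; rewrite mxE !sum3 M01 M02 M12 M10 M20 M21 /T /harm /=; ring.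
Qed.

Definition offdiag0 (M : 'M[R]_3) := [/\ M i0 i1 = 0, M i0 i2 = 0 & M i1 i2 = 0].

Lemma offdiag0P (M : 'M[R]_3) : is_sym2 M -> offdiag0 M -> forall i j, i != j -> M i j = 0.
Proof.
move=> symM [M01 M02 M12]; do 2!elim/ord3_ind => //.
- by rewrite -symM mxE.
- by rewrite -symM mxE.
- by rewrite -symM mxE.
Qed.

(** The triple [(a, b, -(a + b))] is orthogonal to [p] and to [(1, 1, 1)], hence a multiple of their
    cross product. *)
Lemma row_orth (p0 p1 p2 a b : R) :
  ~~ [&& p1 - p2 == 0, p2 - p0 == 0 & p0 - p1 == 0] ->
  a * (p0 - p2) + b * (p1 - p2) = 0 ->
  exists s, a = s * (p1 - p2) /\ b = s * (p2 - p0).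
Proof.
move=> n0 e; have [x0|x0] := eqVneq (p1 - p2) 0; last first.
  exists (a / (p1 - p2)); split; first by rewrite divfK.
  by apply: (mulIf x0); rewrite mulrAC divfK //; lra.
have y0 : p2 - p0 != 0 by apply: contraNneq n0 => y0; rewrite x0 y0 !eqxx; apply/eqP; lra.
exists (b / (p2 - p0)); split; last by rewrite divfK.
rewrite x0 mulr0; apply: (mulIf y0); rewrite mul0r.
by move: e; rewrite x0; lra.
Qed.

Lemma big_triple_diagonal T : in_H4 T -> offdiag0 (d2 T) -> offdiag0 (c3 T) ->
  offdiag0 (c4 T) -> big_group (symgroup4 T).
Proof.
move=> T_H4 od oc [e01 e02 e12].
have dd := offdiag0P (d2_sym T_H4) od.
have cd := offdiag0P (dcontr42_sym _ T_H4) oc.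
move: e01 e02 e12; rewrite /c4; move: od oc dd cd => [d01 d02 d12].
have := harmE T_H4.
move: (T i1 i1 i2 i2) (T i0 i0 i2 i2) (T i0 i0 i1 i1) (T i0 i0 i0 i1)
  (T i0 i1 i1 i1) (T i0 i0 i0 i2) (T i0 i1 i1 i2) (T i0 i0 i1 i2) (T i1 i1 i1 i2).
move=> h1 h2 h3 a b A B D E TE; subst T.
rewrite {1 2 3}/c3 => -[c01 c02 c12] dd cd.
have [[c00 c11 c22] [c01' c02' c12']] := dcontr42_harm_diag h1 h2 h3 a b A B D E dd.
have [_ [-> -> ->]] := dcontr42_harm_diag h1 h2 h3 a b A B D E cd.
rewrite c01' in c01; rewrite c02' in c02; rewrite c12' in c12.
rewrite /c3 c00 c11 c22.
set T := harm _ _ _ _ _ _ _ _ _ in T_H4 d01 d02 d12 *.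
set p0 := d2 T i0 i0 in c01 c02 c12 *; set p1 := d2 T i1 i1 in c01 c02 c12 *.
set p2 := d2 T i2 i2 in c01 c02 c12 *.
set q0 := (X in _ * (X - _) + _ * _ = 0); set q1 := (X in _ * _ + _ * (X - _) = 0).
set q2 := (X in _ * (_ - X) + _ * _ = 0) => e01 e02 e12.
(* Vanishes exactly when the deviators of [d2] and [c3] are dependent. Otherwise each pair [(a, b)],
   [(A, B)], [(D, E)] solves a nonsingular homogeneous system. *)
pose det := (p0 - p2) * (q1 - q2) - (p1 - p2) * (q0 - q2).
have [det0|det0] := eqVneq det 0; last first.
  have cramer u v : u * (p0 - p2) + v * (p1 - p2) = 0 ->
      u * (q0 - q2) + v * (q1 - q2) = 0 -> u = 0 /\ v = 0.
    move=> e e'; split; apply: (mulfI det0); rewrite mulr0 /det.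
      transitivity ((q1 - q2) * (u * (p0 - p2) + v * (p1 - p2)) -
        (p1 - p2) * (u * (q0 - q2) + v * (q1 - q2))); first by ring.
      by rewrite e e' !mulr0 subr0.
    transitivity ((p0 - p2) * (u * (q0 - q2) + v * (q1 - q2)) -
      (q0 - q2) * (u * (p0 - p2) + v * (p1 - p2))); first by ring.
    by rewrite e e' !mulr0 subr0.
  have [a0 b0] := cramer _ _ c01 e01; have [A0 B0] := cramer _ _ c02 e02.
  have [D0 E0] := cramer _ _ c12 e12.
  by rewrite /T a0 b0 A0 B0 D0 E0; apply: big_diag.
have [/and3P[/eqP x0 /eqP y0 /eqP z0]|n0] :=
    boolP [&& p1 - p2 == 0, p2 - p0 == 0 & p0 - p1 == 0].
  apply: (@big_scalar _ p0) => //.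
  have p10 : p1 = p0 by lra.
  have p20 : p2 = p0 by lra.
  by apply: matrix3P; rewrite [RHS]mxE /= ?mulr1n ?mulr0n;
    first [exact: p10 | exact: p20 | exact: erefl | exact: dd].
have [s3 [aE bE]] := row_orth n0 c01.
have [s2 [AE BE]] := row_orth n0 c02.
have [s1 [DE EE]] := row_orth n0 c12.
have nE : p1 - p2 + (p2 - p0) + (p0 - p1) = 0 by ring.
(* The loop closes here: [n] is built from the diagonal of [d2], which is itself quadratic in [n],
   so [n . p = 0] becomes an equation on [n], the [s_i] and the [h_i]. *)
have p0E : p0 = ondiag h1 h2 h3 s1 s2 s3 (p1 - p2) (p2 - p0) (p0 - p1).
  rewrite {1}/p0 /T d2_harm00 /ondiag ?aE ?bE ?AE ?BE ?DE ?EE; ring.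
have p1E : p1 = ondiag h2 h3 h1 s2 s3 s1 (p2 - p0) (p0 - p1) (p1 - p2).
  rewrite {1}/p1 /T d2_harm11 /ondiag ?aE ?bE ?AE ?BE ?DE ?EE; ring.
have p2E : p2 = ondiag h3 h1 h2 s3 s1 s2 (p0 - p1) (p1 - p2) (p2 - p0).
  rewrite {1}/p2 /T d2_harm22 /ondiag ?aE ?bE ?AE ?BE ?DE ?EE; ring.
rewrite /T aE bE AE BE DE EE; apply: (big_rank_one (z := p0 - p1)) => //.
- by rewrite -[RHS]det0 /det /q0 /q1 /q2; ring.
- by rewrite -[RHS]d12 /T d2_harm12 /offdiag ?aE ?bE ?AE ?BE ?DE ?EE; ring.
- by rewrite -[RHS]d02 /T d2_harm02 /offdiag ?aE ?bE ?AE ?BE ?DE ?EE; ring.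
- by rewrite -[RHS]d01 /T d2_harm01 /offdiag ?aE ?bE ?AE ?BE ?DE ?EE; ring.
- by rewrite -p0E -p1E -p2E; ring.
- rewrite -p0E -p1E -p2E => -[p01 p12].
  by case/negP: n0; rewrite p01 p12 !subrr !eqxx.
Qed.
End DiagonalCase.

(** * The dichotomy *)

Section Dichotomy.
Variable R : realType.
Implicit Types (g k : 'M[R]_3) (T : tensor4 R) (M N : 'M[R]_3) (h a b A B D E : R).

Let r3 : 'M[R]_3 := rot_pi_e3 R.

Definition block M := [/\ M i0 i2 = 0, M i2 i0 = 0, M i1 i2 = 0, M i2 i1 = 0 & M i1 i0 = M i0 i1].

Lemma block_of_sym M : is_sym2 M -> act2 r3 M = M -> block M.
Proof.
move=> symM /matrixP fixM; rewrite /r3 rot_pi_e3E in fixM.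
have M20 : M i2 i0 = M i0 i2 by rewrite -{2}symM mxE.
have M21 : M i2 i1 = M i1 i2 by rewrite -{2}symM mxE.
have M02 : M i0 i2 = 0.
  by have := fixM i0 i2; rewrite act2E !app_rotz; lra.
have M12 : M i1 i2 = 0.
  by have := fixM i1 i2; rewrite act2E !app_rotz; lra.
by split; rewrite ?M20 ?M21 // -{2}symM mxE.
Qed.

Lemma dcontr42_harm_block h1 h2 h3 a b A B D E M :
  let T := harm h1 h2 h3 a b A B D E in
  block M ->
  [/\ dcontr42 T M i0 i0 = h3 * M i1 i1 + h2 * M i2 i2 - (h2 + h3) * M i0 i0 + 2 * a * M i0 i1,
      dcontr42 T M i1 i1 = h3 * M i0 i0 + h1 * M i2 i2 - (h1 + h3) * M i1 i1 + 2 * b * M i0 i1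
    & dcontr42 T M i2 i2 = h2 * M i0 i0 + h1 * M i1 i1 - (h1 + h2) * M i2 i2 - 2 * (a + b) * M i0 i1] /\
  [/\ dcontr42 T M i0 i1 = a * (M i0 i0 - M i2 i2) + b * (M i1 i1 - M i2 i2) + 2 * h3 * M i0 i1,
      dcontr42 T M i0 i2 = A * (M i0 i0 - M i2 i2) + B * (M i1 i1 - M i2 i2) + 2 * D * M i0 i1
    & dcontr42 T M i1 i2 = D * (M i0 i0 - M i2 i2) + E * (M i1 i1 - M i2 i2) + 2 * B * M i0 i1].
Proof.
move=> T [M02 M20 M12 M21 M10].
by split; split; rewrite mxE !sum3 M02 M20 M12 M21 M10 /T /harm /=; ring.
Qed.

(** The determinant of the traceless planar parts; it measures the failure of two block matrices to
    commute. *)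
Definition wedge M N := (M i0 i0 - M i1 i1) * N i0 i1 - (N i0 i0 - N i1 i1) * M i0 i1.

Lemma block_commutator M N : block M -> block N ->
  M *m N - N *m M = wedge M N *: mx3 0 1 0 (-1) 0 0 0 0 0.
Proof.
move=> [M02 M20 M12 M21 M10] [N02 N20 N12 N21 N10].
by apply: matrix3P; rewrite !mxE !sum3 ?mxE /= /wedge ?M02 ?M20 ?M12 ?M21 ?M10
  ?N02 ?N20 ?N12 ?N21 ?N10; ring.
Qed.

Lemma act2_fix_comm g M : SO3 g -> act2 g M = M -> g *m M = M *m g.
Proof.
move=> g_SO gM; rewrite -{2}gM /act2 -!mulmxA.
by rewrite SO3_trmulmx // mulmx1.
Qed.

(** Such a [g] commutes with [M] and [N], hence with their commutator, a nonzero multiple of the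
    infinitesimal rotation about [e3]. So [g] is a rotation about [e3]. *)
Lemma fix_wedge_neq0 g M N : SO3 g -> block M -> block N -> wedge M N != 0 ->
  act2 g M = M -> act2 g N = N -> g = 1%:M \/ g = r3.
Proof.
move=> g_SO bM bN w0 /(act2_fix_comm g_SO) gM /(act2_fix_comm g_SO) gN.
have gJ : g *m mx3 0 1 0 (-1) 0 0 0 0 0 = mx3 0 1 0 (-1) 0 0 0 0 0 *m g.
  apply: (scalerI w0); rewrite scalemxAr scalemxAl -block_commutator //.
  by rewrite mulmxBr mulmxBl !mulmxA gM gN -!mulmxA gM gN !mulmxA.
have /matrixP J := gJ.
have := J i0 i0; have := J i0 i1; have := J i0 i2; have := J i1 i2.
have := J i2 i0; have := J i2 i1.
rewrite !mxE !sum3 !mxE /= => J21 J20 J12 J02 J01 J00 {J gJ}.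
have g21 : g i2 i1 = 0 by lra.
have g20 : g i2 i0 = 0 by lra.
have g12 : g i1 i2 = 0 by lra.
have g02 : g i0 i2 = 0 by lra.
have g11 : g i1 i1 = g i0 i0 by lra.
have g10 : g i1 i0 = - g i0 i1 by lra.
case: (g_SO) => gg; rewrite det3 g21 g20 g12 g02 g11 g10 => dg.
have n0 : g i0 i0 ^+ 2 + g i0 i1 ^+ 2 = 1.
  move/matrixP: gg => /(_ i0 i0); rewrite !mxE sum3 !mxE /= g02 => gg00.
  by rewrite -[RHS]gg00; ring.
have g22 : g i2 i2 = 1.
  by rewrite -[RHS]dg -[LHS]mul1r -n0; ring.
(* The sine of the angle annihilates the planar deviators of [M] and [N], hence also their wedge. *)
have g01 : g i0 i1 = 0.
  have comm M' : block M' -> g *m M' = M' *m g ->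
      g i0 i1 * (M' i0 i0 - M' i1 i1) = 0 /\ g i0 i1 * M' i0 i1 = 0.
    move=> [_ _ _ _ M10] /matrixP gM'; have := gM' i0 i0; have := gM' i0 i1.
    by rewrite !mxE !sum3 g21 g20 g02 g11 g10 M10; lra.
  have [m0 m1] := comm _ bM gM; have [n0' n1] := comm _ bN gN.
  apply: (mulIf w0); rewrite mul0r /wedge mulrBr !mulrA m0 n0'.
  by rewrite !mul0r subr0.
rewrite g01 expr0n addr0 in n0.
move/eqP: n0; rewrite sqrf_eq1 => /orP[/eqP g00|/eqP g00]; [left|right].
  by apply: matrix3P; rewrite ?(g00, g01, g02, g10, g11, g12, g20, g21, g22) mxE //= ?oppr0.
by rewrite /r3; apply: matrix3P;
  rewrite ?(g00, g01, g02, g10, g11, g12, g20, g21, g22) mxE //= ?oppr0.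
Qed.

(** Both [u] and [v] lie on the line spanned by the cross product of [r] and [t], whose first
    coordinate is assumed nonzero. *)
Lemma cross_cramer (r0 r1 r2 t0 t1 t2 u0 u1 u2 v0 v1 v2 : R) :
  r0 * u0 + r1 * u1 + r2 * u2 = 0 -> r0 * v0 + r1 * v1 + r2 * v2 = 0 ->
  t0 * u0 + t1 * u1 + t2 * u2 = 0 -> t0 * v0 + t1 * v1 + t2 * v2 = 0 ->
  r1 * t2 - r2 * t1 != 0 ->
  [/\ u1 * v2 = u2 * v1, u0 * v2 = u2 * v0 & u0 * v1 = u1 * v0].
Proof.
move=> ru rv tu tv w0; set w := _ - _ in w0.
have solve x0 x1 x2 : r0 * x0 + r1 * x1 + r2 * x2 = 0 -> t0 * x0 + t1 * x1 + t2 * x2 = 0 ->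
    x1 = (r2 * t0 - r0 * t2) / w * x0 /\ x2 = (r0 * t1 - r1 * t0) / w * x0.
  move=> rx tx; split; apply: (mulfI w0); rewrite mulrA mulrCA divff // mulr1.
    apply/eqP; rewrite -subr_eq0; apply/eqP.
    transitivity (t2 * (r0 * x0 + r1 * x1 + r2 * x2) - r2 * (t0 * x0 + t1 * x1 + t2 * x2)).
      by rewrite /w; ring.
    by rewrite rx tx !mulr0 subr0.
  apply/eqP; rewrite -subr_eq0; apply/eqP.
  transitivity (r1 * (t0 * x0 + t1 * x1 + t2 * x2) - t1 * (r0 * x0 + r1 * x1 + r2 * x2)).
    by rewrite /w; ring.
  by rewrite rx tx !mulr0 subr0.
have [-> ->] := solve _ _ _ ru tu; have [-> ->] := solve _ _ _ rv tv.
by split; ring.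
Qed.

(** [F1] and [F2] compute the planar deviator of [H:M] from [M] modulo the identity. By linearity,
    proportionality of [d2] and [c3] passes to [c3] and [c4]; the identities in the proof avoid
    dividing by a ratio. *)
Lemma parallel_propagate h1 h2 h3 a b (u0 u1 u2 v0 v1 v2 : R) :
  let F1 x0 x1 x2 := (2 * h3 + h1) * x1 - (h2 + 2 * h3) * x0 + 2 * (a - b) * x2 in
  let F2 x0 x1 x2 := a * x0 + b * x1 + 2 * h3 * x2 in
  u1 * v2 = u2 * v1 -> u0 * v2 = u2 * v0 -> u0 * v1 = u1 * v0 ->
  v0 - v1 = F1 u0 u1 u2 -> v2 = F2 u0 u1 u2 ->
  [/\ (u0 - u1) * v2 - (v0 - v1) * u2 = 0,
      (u0 - u1) * F2 v0 v1 v2 - F1 v0 v1 v2 * u2 = 0 &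
      (v0 - v1) * F2 v0 v1 v2 - F1 v0 v1 v2 * v2 = 0].
Proof.
move=> F1 F2 /eqP + /eqP + /eqP + f1 f2.
rewrite -subr_eq0 => /eqP p12; rewrite -subr_eq0 => /eqP p02.
rewrite -subr_eq0 => /eqP p01; split.
- transitivity ((u0 * v2 - u2 * v0) - (u1 * v2 - u2 * v1)); first by ring.
  by rewrite p12 p02 subr0.
- transitivity ((a + b) * (u0 * v1 - u1 * v0) - h2 * (u0 * v2 - u2 * v0) +
    h1 * (u1 * v2 - u2 * v1) + ((v0 - v1) * F2 u0 u1 u2 - F1 u0 u1 u2 * v2)).
    by rewrite /F1 /F2; ring.
  by rewrite p12 p02 p01 -f1 -f2; ring.
- rewrite f1 {3}f2.
  transitivity ((- (h2 + 2 * h3) * b - (2 * h3 + h1) * a) * (u0 * v1 - u1 * v0) +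
    (- (h2 + 2 * h3) * (2 * h3) - 2 * (a - b) * a) * (u0 * v2 - u2 * v0) +
    ((2 * h3 + h1) * (2 * h3) - 2 * (a - b) * b) * (u1 * v2 - u2 * v1)).
    by rewrite /F1 /F2; ring.
  by rewrite p12 p02 p01; ring.
Qed.

Definition parallel_triple T :=
  [/\ wedge (d2 T) (c3 T) = 0, wedge (d2 T) (c4 T) = 0 & wedge (c3 T) (c4 T) = 0].

Lemma odd_part_eq0 T : in_H4 T -> T i1 i2 i2 i2 = 0 ->
  block (d2 T) -> block (c3 T) -> block (c4 T) -> ~ parallel_triple T ->
  act4 r3 T = T.
Proof.
move=> T_H4 + bd bc be; move: bd bc be.
have := harmE T_H4.
move: (T i1 i1 i2 i2) (T i0 i0 i2 i2) (T i0 i0 i1 i1) (T i0 i0 i0 i1)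
  (T i0 i1 i1 i1) (T i0 i0 i0 i2) (T i0 i1 i1 i2) (T i0 i0 i1 i2) (T i1 i1 i1 i2).
move=> h1 h2 h3 a b A B D E TE; subst T.
set T := harm _ _ _ _ _ _ _ _ _ in T_H4 *.
move=> bd bc be T1222 np.
have ED : E = - D by move: T1222; rewrite /T /harm /=; lra.
have [[c00 c11 c22] [c01 c02 c12]] := dcontr42_harm_block h1 h2 h3 a b A B D E bd.
have [[e00 e11 e22] [e01 e02 e12]] := dcontr42_harm_block h1 h2 h3 a b A B D E bc.
rewrite -/T -/(c3 T) in c00 c11 c22 c01 c02 c12.
rewrite -/T -/(c4 T) in e00 e11 e22 e01 e02 e12.
have [d02 _ d12 _ _] := bd; have [c02_0 _ c12_0 _ _] := bc; have [e02_0 _ e12_0 _ _] := be.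
rewrite c02_0 in c02; rewrite c12_0 in c12; rewrite e02_0 in e02; rewrite e12_0 in e12.
have BD0 : B ^+ 2 + D ^+ 2 = 0.
  apply/eqP; apply: contraT => BD; case: np.
  set u0 := d2 T i0 i0 - d2 T i2 i2 in c02 c12 c01.
  set u1 := d2 T i1 i1 - d2 T i2 i2 in c02 c12 c01.
  set v0 := c3 T i0 i0 - c3 T i2 i2 in e02 e12 e01.
  set v1 := c3 T i1 i1 - c3 T i2 i2 in e02 e12 e01.
  (* The rows [(A, B, D)] and [(D, -D, B)] of the odd-even block have [B^2 + D^2] as first
     coordinate of their cross product; the normalisation [H_2333 = 0] is what makes it a sum of
     squares. *)
  have [|||||p12 p02 p01] := @cross_cramer A B D D (- D) B u0 u1 (2 * d2 T i0 i1)
    v0 v1 (2 * c3 T i0 i1).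
  - by rewrite [RHS]c02; ring.
  - by rewrite [RHS]e02; ring.
  - by rewrite [RHS]c12 ED; ring.
  - by rewrite [RHS]e12 ED; ring.
  - by rewrite (_ : _ - _ = B ^+ 2 + D ^+ 2) //; ring.
  have half (x y z t : R) : x * (2 * y) = 2 * z * t -> x * y = z * t by lra.
  have [||w1 w2 w3] := @parallel_propagate h1 h2 h3 a b u0 u1 (d2 T i0 i1) v0 v1 (c3 T i0 i1)
    (half _ _ _ _ p12) (half _ _ _ _ p02) p01.
  - by rewrite /v0 /v1 /u0 /u1 c00 c11; ring.
  - by rewrite c01.
  split.
  - by rewrite -[RHS]w1 /wedge /u0 /u1 /v0 /v1; ring.
  - by rewrite -[RHS]w2 /wedge e00 e11 e01 /u0 /u1 /v0 /v1; ring.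
  - by rewrite -[RHS]w3 /wedge e00 e11 e01 /v0 /v1; ring.
move/eqP: BD0; rewrite paddr_eq0 ?sqr_ge0 // !sqrf_eq0 => /andP[/eqP B0 /eqP D0].
have E0 : E = 0 by rewrite ED D0 oppr0.
have [A0|A0] := eqVneq A 0.
  by rewrite /T A0 B0 D0 E0 /r3 act4_rot_pi_e3 oppr0.
case: np.
(* Only [A] survives in the odd part. Cancelling it successively gives [d2_11 = d2_33], [h1 = h3]
   and [4a + 3b = 0]; the first of these then becomes [b^2 = 0]. *)
have u0 : d2 T i0 i0 - d2 T i2 i2 = 0.
  by apply: (mulfI A0); rewrite mulr0 c02 B0 D0; ring.
have h13 : h1 - h3 = 0.
  by apply: (mulfI A0); rewrite mulr0 -[RHS]d02 /T d2_harm02 B0 D0 E0; ring.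
have ab : 4 * a + 3 * b = 0.
  by apply: (mulfI A0); rewrite mulr0 -[RHS]d12 /T d2_harm12 B0 D0 E0; ring.
have b0 : b = 0.
  have aE : a = - (3 / 4 * b) by lra.
  have hE : h1 = h3 by lra.
  apply/eqP; rewrite -sqrf_eq0; apply/eqP.
  have : 5 / 2 * b ^+ 2 = 0.
    by rewrite -[RHS]u0 /T d2_harm00 d2_harm22 B0 D0 E0 hE aE; field.
  by lra.
have a0 : a = 0 by lra.
have d01 : d2 T i0 i1 = 0 by rewrite /T d2_harm01 B0 D0 E0 a0 b0; ring.
have c01_0 : c3 T i0 i1 = 0 by rewrite c01 d01 a0 b0; ring.
have e01_0 : c4 T i0 i1 = 0 by rewrite e01 c01_0 a0 b0; ring.
by split; rewrite /wedge ?d01 ?c01_0 ?e01_0; ring.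
Qed.

(** The rotation that diagonalises the first nonzero pair serves for every pair parallel to it. *)
Lemma parallel_rotation (p0 q0 p1 q1 p2 q2 : R) :
  p0 * q1 - p1 * q0 = 0 -> p0 * q2 - p2 * q0 = 0 -> p1 * q2 - p2 * q1 = 0 ->
  exists c s, c ^+ 2 + s ^+ 2 = 1 /\
    [/\ c * s * p0 + (c ^+ 2 - s ^+ 2) * q0 = 0,
        c * s * p1 + (c ^+ 2 - s ^+ 2) * q1 = 0 &
        c * s * p2 + (c ^+ 2 - s ^+ 2) * q2 = 0].
Proof.
have follow (p q p' q' c s : R) : ~~ ((p == 0) && (q == 0)) -> p * q' - p' * q = 0 ->
    c * s * p + (c ^+ 2 - s ^+ 2) * q = 0 -> c * s * p' + (c ^+ 2 - s ^+ 2) * q' = 0.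
  rewrite negb_and => /orP[] n0 w0 e; apply: (mulfI n0); rewrite mulr0.
    transitivity (p' * (c * s * p + (c ^+ 2 - s ^+ 2) * q) +
      (c ^+ 2 - s ^+ 2) * (p * q' - p' * q)); first by ring.
    by rewrite e w0 !mulr0 addr0.
  transitivity (q' * (c * s * p + (c ^+ 2 - s ^+ 2) * q) -
    c * s * (p * q' - p' * q)); first by ring.
  by rewrite e w0 !mulr0 subr0.
move=> w01 w02 w12.
have [/andP[/eqP p0_0 /eqP q0_0]|n0] := boolP ((p0 == 0) && (q0 == 0)); last first.
  have [c [s [cs1 e]]] := rotz_diagonalize p0 q0.
  by exists c, s; split=> //; split=> //; [apply: follow w01 e|apply: follow w02 e].
have [/andP[/eqP p1_0 /eqP q1_0]|n1] := boolP ((p1 == 0) && (q1 == 0)); last first.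
  have [c [s [cs1 e]]] := rotz_diagonalize p1 q1.
  exists c, s; split=> //; split=> //; last exact: follow w12 e.
  by rewrite p0_0 q0_0; ring.
have [c [s [cs1 e]]] := rotz_diagonalize p2 q2.
by exists c, s; split=> //; split=> //; rewrite ?p0_0 ?q0_0 ?p1_0 ?q1_0; ring.
Qed.

Lemma big_parallel T : in_H4 T -> block (d2 T) -> block (c3 T) -> block (c4 T) ->
  parallel_triple T -> big_group (symgroup4 T).
Proof.
move=> T_H4 bd bc be [w01 w02 w12].
have [c [s [cs1 [od oc oe]]]] := parallel_rotation w01 w02 w12.
have k_SO := rotz_SO3 cs1.
have offd M : block M -> c * s * (M i0 i0 - M i1 i1) + (c ^+ 2 - s ^+ 2) * M i0 i1 = 0 ->
    offdiag0 (act2 (rotz c s) M).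
  move=> [M02 M20 M12 M21 M10] e; split; rewrite act2E !app_rotz ?M02 ?M12; try ring.
  by rewrite M10 -[RHS]e; ring.
apply: (big_group_act4 k_SO); apply: big_triple_diagonal; first exact: act4_in_H4.
- by rewrite d2_equiv //; apply: offd.
- by rewrite c3_equiv //; apply: offd.
- by rewrite c4_equiv //; apply: offd.
Qed.

Definition dichotomy T r := big_group (symgroup4 T) \/
  symgroup4 T r /\ forall k, symgroup_family2 (triple T) k -> k = 1%:M \/ k = r.

Lemma dichotomy_conj T g r : in_H4 T -> SO3 g ->
  dichotomy (act4 g T) (g *m r *m g^T) -> dichotomy T r.
Proof.
move=> T_H4 g_SO; have gg := SO3_trmulmx g_SO.
have conjK k : g^T *m (g *m k *m g^T) *m g = k.
  by rewrite !mulmxA gg mul1mx -mulmxA gg mulmx1.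
case=> [/(big_group_act4 g_SO)|[/(symgroup4_conj g_SO) rT tT]]; first by left.
right; split=> [|k /(symgroup_triple_conj T_H4 g_SO)/tT[] e]; first by rewrite conjK in rT.
- by left; rewrite -(conjK k) e mulmx1.
- by right; rewrite -(conjK k) e conjK.
Qed.

Lemma triple_block T : in_H4 T -> symgroup_family2 (triple T) r3 ->
  [/\ block (d2 T), block (c3 T) & block (c4 T)].
Proof.
move=> T_H4 [_ fixT]; split; apply: block_of_sym; try exact: dcontr42_sym.
- exact: d2_sym.
- by apply: fixT; left.
- by apply: fixT; right; left.
- by apply: fixT; right; right.
Qed.

Lemma dichotomy_adapted T : in_H4 T -> T i1 i2 i2 i2 = 0 ->
  symgroup_family2 (triple T) r3 -> dichotomy T r3.
Proof.
move=> T_H4 T1222 r3T; have [bd bc be] := triple_block T_H4 r3T.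
have [par|npar] := pselect (parallel_triple T); first by left; apply: big_parallel.
right; split=> [|k [k_SO fixT]].
  by apply/symgroup4P; split; [case: r3T|apply: odd_part_eq0].
have kd : act2 k (d2 T) = d2 T by apply: fixT; left.
have kc : act2 k (c3 T) = c3 T by apply: fixT; right; left.
have ke : act2 k (c4 T) = c4 T by apply: fixT; right; right.
have [w01|w01] := eqVneq (wedge (d2 T) (c3 T)) 0; last exact: fix_wedge_neq0 w01 kd kc.
have [w02|w02] := eqVneq (wedge (d2 T) (c4 T)) 0; last exact: fix_wedge_neq0 w02 kd ke.
have [w12|w12] := eqVneq (wedge (c3 T) (c4 T)) 0; last exact: fix_wedge_neq0 w12 kc ke.
by case: npar.
Qed.

(** Rotations about [e3] commute with the half-turn about [e3], so [H_2333 = 0] can be reached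
    without moving it. *)
Lemma dichotomy_e3 T : in_H4 T -> symgroup_family2 (triple T) r3 -> dichotomy T r3.
Proof.
move=> T_H4 r3T.
have [c [s [cs1 e]]] := rotz_annihilate (T i0 i2 i2 i2) (T i1 i2 i2 i2).
have k_SO := rotz_SO3 cs1.
have kr : rotz c s *m r3 *m (rotz c s)^T = r3.
  rewrite -mulmxA (_ : r3 *m _ = (rotz c s)^T *m r3).
    by rewrite mulmxA; case: k_SO => -> _; rewrite mul1mx.
  by rewrite /r3 rot_pi_e3E; apply: matrix3P; rewrite !mxE !sum3 !mxE /=; ring.
apply: (dichotomy_conj T_H4 k_SO); rewrite kr; apply: dichotomy_adapted.
- exact: act4_in_H4.
- by rewrite act4E !app_rotz.
- by rewrite -kr; apply: symgroup_triple_conj.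
Qed.

Lemma dichotomyP T g : in_H4 T -> SO3 g ->
  symgroup_family2 (triple T) (g *m r3 *m g^T) -> dichotomy T (g *m r3 *m g^T).
Proof.
move=> T_H4 g_SO rT; have gg := SO3_trmulmx g_SO.
have e : g^T *m (g *m r3 *m g^T) *m g^T^T = r3.
  by rewrite trmxK !mulmxA gg mul1mx -mulmxA gg mulmx1.
apply: (dichotomy_conj T_H4 (SO3_tr g_SO)); rewrite e.
apply: dichotomy_e3; first by apply: act4_in_H4 => //; apply: SO3_tr.
by rewrite -e; apply: symgroup_triple_conj => //; apply: SO3_tr.
Qed.
End Dichotomy.

(** * From the dichotomy to the equivalences *)

Theorem theorem9p15 (R : realType) (H : tensor4 R) (hH : in_H4 H) :
  (monoclinic4 H <-> monoclinic_family2 (Cov2 H)) /\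
  (monoclinic_family2 (Cov2 H) <-> monoclinic_family2 (triple H)) /\
  (monoclinic4 H ->
     forall g : 'M[R]_3, symgroup4 H g <-> symgroup_family2 (triple H) g).
Proof.
have HC g := @symgroup4_sub_Cov2 R H g hH.
have CT g := @symgroup_Cov2_sub_triple R H g hH.
(* If any group [G] between those of [H] and of the triple has class [[Z_2]], its half-turn fixes
   the triple. The large alternative would make [G] large, so the group of the triple is [{1, r}]
   and lies in that of [H]. *)
have key (G : 'M[R]_3 -> Prop) :
    (forall g, symgroup4 H g -> G g) -> (forall g, G g -> symgroup_family2 (triple H) g) ->
    in_class_Z2 G -> forall g, symgroup_family2 (triple H) g -> symgroup4 H g.
  move=> HG GT GZ2; have [k [k_SO GE]] := GZ2.
  have Gr : G (k *m rot_pi_e3 R *m k^T) by apply/GE; exists (rot_pi_e3 R); split=> //; right.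
  have [/(big_group_sub HG)/big_group_not_Z2//|[Hr tT] g /tT[] ->//] :=
    dichotomyP hH k_SO (GT _ Gr).
  by split; [apply: SO3_1|move=> *; rewrite act4_1].
have class_eq (G G' : 'M[R]_3 -> Prop) :
    (forall g, G g <-> G' g) -> in_class_Z2 G -> in_class_Z2 G'.
  by move=> GG' [k [k_SO GE]]; exists k; split=> // h; rewrite -GG'.
have HT4 g : symgroup4 H g -> symgroup_family2 (triple H) g by move/HC/CT.
have k1 := key _ (fun g Hg => Hg) HT4.
have k2 := key _ HC CT.
have k3 := key _ HT4 (fun g Tg => Tg).
split; [|split]; first split.
- by move=> mH; apply: class_eq (mH) => g; split=> [/HC//|/CT/(k1 mH)].
- by move=> mC; apply: class_eq (mC) => g; split=> [/CT/(k2 mC)//|/HC].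
- split=> m.
  + by apply: class_eq (m) => g; split=> [/CT//|/(k2 m)/HC].
  + by apply: class_eq (m) => g; split=> [/(k3 m)/HC//|/CT].
- by move=> mH g; split=> [/HT4//|/(k1 mH)].
Qed.
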